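(* Let $f:X\to X$ be a continuous map on a compact metric space $X$ that is a Besicovitch space, with $h_{\rm top}(f)<\infty$. Let $\varphi:X\to\mathbb{R}$ and $\Phi:X\to\mathbb{R}^m$ be continuous and let $w\in \mathrm{Rot}(\Phi)$ be such that the map $v\mapsto P_{\rm m}(\varphi,\Phi,v)$ (defined on $\mathrm{Rot}(\Phi)$) is continuous at $w$ and $P_{\rm m}(\varphi,\Phi,w)$ is approximated by ergodic measures. Then $P_{\rm top}(\varphi,\Phi,w)=P_{\rm m}(\varphi,\Phi,w)$.
   Context: Let $(X,d)$ be a compact metric space and $f:X\to X$ continuous. $\mathcal{M}$ is the set of Borel $f$-invariant probability measures on $X$ with the weak$^*$ topology, $\mathcal{M}_E\subset\mathcal{M}$ the ergodic ones, $h_\mu(f)$ the measure-theoretic entropy, $h_{\rm top}(f)$ the topological entropy. For $\Phi=(\phi_1,\dots,\phi_m):X\to\mathbb{R}^m$ continuous and $\mu\in\mathcal{M}$, the rotation vector is $\mathrm{rv}(\mu)=(\int\phi_1\,d\mu,\dots,\int\phi_m\,d\mu)$. The generalized rotation set is $\mathrm{Rot}(\Phi)=\{\mathrm{rv}(\mu):\mu\in\mathcal{M}\}$, and for $w\in\mathrm{Rot}(\Phi)$, $\mathcal{M}_\Phi(w)=\{\mu\in\mathcal{M}:\mathrm{rv}(\mu)=w\}$. Localized measure-theoretic pressure: $P_{\rm m}(\varphi,\Phi,w)=\sup\{h_\mu(f)+\int_X\varphi\,d\mu:\mu\in\mathcal{M}_\Phi(w)\}$ for $w\in\mathrm{Rot}(\Phi)$.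 Localized topological pressure: for $n\in\mathbb{N}$ put $d_n(x,y)=\max_{0\le k\le n-1}d(f^k(x),f^k(y))$; $F\subset X$ is $(n,\varepsilon)$-separated if $d_n(x,y)\ge\varepsilon$ for all distinct $x,y\in F$. Let $S_n\varphi(x)=\sum_{k=0}^{n-1}\varphi(f^k(x))$ and $S_n\Phi=(S_n\phi_1,\dots,S_n\phi_m)$. For $w\in\mathbb{R}^m$, $r>0$, $F$ is an $(n,\varepsilon,w,r)$-set if it is $(n,\varepsilon)$-separated and $\frac1n S_n\Phi(x)\in D(w,r)$ for all $x\in F$, where $D(w,r)$ is the Euclidean ball with center $w$ and radius $r$. Put $N_\varphi(n,\varepsilon,w,r)=\sup\{\sum_{x\in F}e^{S_n\varphi(x)}: F \text{ is an }(n,\varepsilon,w,r)\text{-set}\}$ and $$P_{\rm top}(\varphi,\Phi,w)=\lim_{r\to0}\lim_{\varepsilon\to0}\limsup_{n\to\infty}\frac1n\log N_\varphi(n,\varepsilon,w,r).$$ $P_{\rm m}(\varphi,\Phi,w)$ is approximated by ergodic measures if there is a sequence $(\mu_n)\subset\mathcal{M}_E$ with $\mathrm{rv}(\mu_n)\to w$ and $h_{\mu_n}(f)+\int\varphi\,d\mu_n\to P_{\rm m}(\varphi,\Phi,w)$ as $n\to\infty$. A metric space $X$ is a Besicovitch space if the Besicovitch covering theorem holds in it: there is an integer $\beta$ such that for every $A\subset X$ and every family of closed balls with bounded radii such that each point of $A$ is the center of some ball of the family, there are $\beta$ subfamilies, each consisting of pairwise disjoint balls, whose union covers $A$. *)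

(* Defs.v *)
From HB Require Import structures.
From mathcomp Require Import all_boot all_order all_algebra.
From mathcomp Require Import all_classical all_reals all_analysis.
Set Implicit Arguments.
Unset Strict Implicit.
Unset Printing Implicit Defensive.
Import Order.TTheory GRing.Theory Num.Theory.
Import numFieldNormedType.Exports.
Local Open Scope classical_set_scope.
Local Open Scope ring_scope.

(* [measurableType] requires a point; a space carrying an invariant
   probability measure is nonempty, so this loses no generality. *)
#[short(type="pmetricType")]
HB.structure Definition PointedMetric (R : numDomainType) :=
  {T of Pointed T & Metric R T}.

Notation borel X := (g_sigma_algebraType (@open X)).

Section Besicovitch.
Context {R : realType} (X : metricType R).

(* Not the library's [closed_ball], which is the closure of the open ball. *)
Definition cball (x : X) (r : R) : set X := [set y | mdist x y <= r].

(* In a general metric space a ball does not determine its center and radius,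
   so a family of closed balls is a set of pairs (center, radius). *)
Definition besicovitch_space := exists beta : nat,
  forall (A : set X) (F : set (X * R)),
    (forall p, F p -> 0 < p.2) ->
    (exists M, forall p, F p -> p.2 <= M) ->
    (forall x, A x -> exists r, F (x, r)) ->
  exists G : 'I_beta -> set (X * R),
    [/\ forall i, G i `<=` F,
        forall i, trivIset (G i) (fun p => cball p.1 p.2) &
        A `<=` \bigcup_i \bigcup_(p in G i) cball p.1 p.2].

End Besicovitch.

Section Topological.
Context {R : realType} {X : metricType R} (f : X -> X).

Definition birkhoff (V : nmodType) (g : X -> V) (n : nat) (x : X) : V :=
  \sum_(k < n) g (iter k f x).

Definition bowen_dist (n : nat) (x y : X) : R :=
  \big[Num.max/0]_(k < n) mdist (iter k f x) (iter k f y).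

Definition bowen_separated (n : nat) (e : R) (F : set X) :=
  forall x y, F x -> F y -> x <> y -> e <= bowen_dist n x y.

Definition htop : \bar R :=
  lim ((fun e : R => limn_esup (fun n : nat =>
     (n%:R^-1)%:E * lne (ereal_sup [set counting F | F in bowen_separated n e])))%E
    @ 0^'+).

(* Euclidean distance; the library norm on ['rV[R]_m] is the sup norm. *)
Definition edist (m : nat) (v w : 'rV[R]_m) : R :=
  Num.sqrt (\sum_i (v ord0 i - w ord0 i) ^+ 2).

Definition ball_separated (m : nat) (Phi : X -> 'rV[R]_m)
    (n : nat) (e : R) (w : 'rV[R]_m) (r : R) (F : set X) :=
  bowen_separated n e F /\
  forall x, F x -> edist w (n%:R^-1 *: birkhoff Phi n x) < r.

Definition Nphi (m : nat) (phi : X -> R) (Phi : X -> 'rV[R]_m)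
    (n : nat) (e : R) (w : 'rV[R]_m) (r : R) : \bar R :=
  ereal_sup [set (\esum_(x in F) (expR (birkhoff phi n x))%:E) |
             F in ball_separated Phi n e w r].

Definition Ptop (m : nat) (phi : X -> R) (Phi : X -> 'rV[R]_m)
    (w : 'rV[R]_m) : \bar R :=
  lim ((fun r : R =>
    lim ((fun e : R => limn_esup (fun n : nat =>
       (n%:R^-1)%:E * lne (Nphi phi Phi n e w r)))%E
      @ 0^'+)) @ 0^'+).

End Topological.

Section MeasureTheoretic.
Context {R : realType} {X : pmetricType R} (f : X -> X).
Implicit Types (mu : probability (borel X) R).

Definition invariant_measure mu :=
  forall A : set (borel X), measurable A -> mu (f @^-1` A) = mu A.

Definition ergodic_measure mu := invariant_measure mu /\
  forall A : set (borel X), measurable A -> f @^-1` A = A ->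
    mu A = 0%E \/ mu A = 1%E.

(* A finite measurable partition is given by its labelling [xi : X -> 'I_k];
   empty cells are allowed and do not contribute to the entropy. *)
Definition measurable_partition (k : nat) (xi : borel X -> 'I_k) :=
  forall i, measurable (xi @^-1` [set i]).

(* The cell of the join of the f^{-i} xi, i < n, with itinerary [s]. *)
Definition cell (k : nat) (xi : borel X -> 'I_k) (n : nat)
    (s : {ffun 'I_n -> 'I_k}) : set (borel X) :=
  [set x | forall i : 'I_n, xi (iter i f x) = s i].

(* [ln 0 = 0], so null cells contribute 0. *)
Definition join_entropy mu (k : nat) (xi : borel X -> 'I_k) (n : nat) : R :=
  - \sum_(s : {ffun 'I_n -> 'I_k})
      fine (mu (cell xi s)) * ln (fine (mu (cell xi s))).

Definition partition_entropy mu (k : nat) (xi : borel X -> 'I_k) : R :=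
  limn (fun n : nat => n%:R^-1 * join_entropy mu xi n).

Definition measure_entropy mu : \bar R :=
  ereal_sup [set h | exists (k : nat) (xi : borel X -> 'I_k),
    measurable_partition xi /\ h = (partition_entropy mu xi)%:E].

Definition mean mu (phi : X -> R) : R := Rintegral mu setT phi.

Definition rv (m : nat) (Phi : X -> 'rV[R]_m) mu : 'rV[R]_m :=
  \row_i mean mu (fun x => Phi x ord0 i).

Definition MPhi (m : nat) (Phi : X -> 'rV[R]_m) (w : 'rV[R]_m) :
    set (probability (borel X) R) :=
  [set mu | invariant_measure mu /\ rv Phi mu = w].

Definition Rot (m : nat) (Phi : X -> 'rV[R]_m) : set 'rV[R]_m :=
  [set rv Phi mu | mu in invariant_measure].

Definition free_energy (phi : X -> R) mu : \bar R :=
  (measure_entropy mu + (mean mu phi)%:E)%E.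

Definition Pm (m : nat) (phi : X -> R) (Phi : X -> 'rV[R]_m)
    (w : 'rV[R]_m) : \bar R :=
  ereal_sup [set free_energy phi mu | mu in MPhi Phi w].

Definition ergodic_approximated (m : nat) (phi : X -> R)
    (Phi : X -> 'rV[R]_m) (w : 'rV[R]_m) :=
  exists mu_ : nat -> probability (borel X) R,
    [/\ forall n, ergodic_measure (mu_ n),
        rv Phi (mu_ n) @[n --> \oo] --> w &
        free_energy phi (mu_ n) @[n --> \oo] --> Pm phi Phi w].

End MeasureTheoretic.

(* Main.v *)
(* Lower bound: for an ergodic measure [mu] whose rotation vector is close to
   [w], the weak law of large numbers gives a set of probability close to 1 on
   which the Birkhoff averages of [Phi] and [phi] are close to their means.  The
   names of its points with respect to a partition carry almost all the entropy,
   and up to a subexponential factor they are separated by a Bowen-separated set.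
   Hence P_top >= h_mu + int phi - o(1), and one lets [mu] run through the
   approximating sequence.

   Upper bound: weight the points of optimal (n, e, w, r)-sets by exp(S_n phi)
   and average along the orbits.  A limit point of these measures is invariant,
   its rotation vector is within [r] of [w], and by Misiurewicz's argument its
   free energy is at least the exponential growth rate.  So the growth rate is
   at most the supremum of P_m over a neighbourhood of [w] in the rotation set,
   and continuity of P_m at [w] concludes. *)
From HB Require Import structures.
Require Import Defs.
From mathcomp Require Import all_boot all_order all_algebra.
From mathcomp Require Import all_classical all_reals all_analysis.
From mathcomp Require Import measurable_realfun.
From mathcomp Require Import ring lra zify.
Import Order.TTheory GRing.Theory Num.Theory.
Import numFieldNormedType.Exports.
Set Implicit Arguments.
Unset Strict Implicit.
Unset Printing Implicit Defensive.
Local Open Scope classical_set_scope.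
Local Open Scope ring_scope.

(** The obstacle in the upper bound is that the entropy of a partition is not continuous in the
    measure. The limit is taken along an ultrafilter and for all bounded functions at once: the
    limit functional [Lam] then has values on indicators and is invariant under [f] there too. On
    indicators, however, [Lam] is only finitely additive and may differ from the probability [mu]
    that represents it on continuous functions; the two agree on sets with [mu]-null boundary. Hence
    the partition is chosen after [mu], with such cells, and with diameters below [e] so that
    separated points have distinct names. In the lower bound the cells are merely measurable, so
    close orbits can have different names. Each cell is replaced by a closed core; distinct cores
    have a positive gap and typical orbits rarely leave the cores, so close orbits have names at
    small Hamming distance, and Hamming balls of small radius grow at a small exponential rate.
    Gibbs' inequality is the source of the main entropy estimates on both sides. *)

(** * Entropy of finite distributions and Gibbs' inequality *)

Section FiniteEntropy.
Context {R : realType}.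
Implicit Types T : finType.

Definition entropy T (p : T -> R) : R := - \sum_t p t * ln (p t).

Definition pushfwd T T' (g : T -> T') (p : T -> R) (t' : T') : R :=
  \sum_(t | g t == t') p t.

(** This is [ln u <= u - 1] at [u = q t / p t], weighted by [p t]. Since [ln 0 = 0], a zero of [q]
    where [p] is positive would wrongly cost nothing; the support condition excludes it. Allowing
    [q] to have smaller mass than [p] admits restrictions of product laws. *)
Lemma gibbs T (p q : T -> R) :
  (forall t, 0 <= p t) -> (forall t, 0 <= q t) ->
  (forall t, q t = 0 -> p t = 0) -> \sum_t q t <= \sum_t p t ->
  entropy p <= - \sum_t p t * ln (q t).
Proof.
move=> p0 q0 qp sqp; rewrite /entropy lerN2 -subr_le0 -sumrB.
apply: (@le_trans _ _ (\sum_t (q t - p t))); last by rewrite sumrB subr_le0.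
apply: ler_sum => t _; rewrite -mulrBr.
have [pt0|ptN0] := eqVneq (p t) 0; first by rewrite pt0 mul0r subr0.
have pt : 0 < p t by rewrite lt_def ptN0 p0.
have qt : 0 < q t.
  by rewrite lt_def q0 andbT; apply: contra_neq ptN0 => /qp.
rewrite -ln_div ?posrE// -ler_pdivlMl//.
have -> : (p t)^-1 * (q t - p t) = q t / p t - 1 by field.
rewrite -[in X in ln X](subrKC 1 (q t / p t)).
by rewrite le_ln1Dx// ltrBrDr addrC subrr divr_gt0.
Qed.

Lemma sum_pushfwd T T' (g : T -> T') (p : T -> R) (F : T' -> R) :
  \sum_t p t * F (g t) = \sum_t' pushfwd g p t' * F t'.
Proof.
rewrite (partition_big g xpredT)//=; apply: eq_bigr => t' _.
by rewrite mulr_suml; apply: eq_bigr => t /eqP ->.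
Qed.

Lemma pushfwd_ge0 T T' (g : T -> T') (p : T -> R) t' :
  (forall t, 0 <= p t) -> 0 <= pushfwd g p t'.
Proof. by move=> p0; apply: sumr_ge0. Qed.

Lemma pushfwd_ge T T' (g : T -> T') (p : T -> R) t :
  (forall t, 0 <= p t) -> p t <= pushfwd g p (g t).
Proof.
by move=> p0; rewrite /pushfwd (bigD1 t)//= lerDl sumr_ge0.
Qed.

Lemma sum1_pushfwd T T' (g : T -> T') (p : T -> R) :
  \sum_t' pushfwd g p t' = \sum_t p t.
Proof. by rewrite [RHS](partition_big g xpredT). Qed.

(** Gibbs' inequality against the product of the marginals. By injectivity the indices [t] are
    distinct points of the product, so the weights used have total mass at most 1. *)
Lemma entropy_subadditive T T1 T2 (g1 : T -> T1) (g2 : T -> T2) (p : T -> R) :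
  injective (fun t => (g1 t, g2 t)) -> (forall t, 0 <= p t) ->
  \sum_t p t = 1 ->
  entropy p <= entropy (pushfwd g1 p) + entropy (pushfwd g2 p).
Proof.
move=> ginj p0 p1.
set p1' := pushfwd g1 p; set p2' := pushfwd g2 p.
apply: (@le_trans _ _ (- \sum_t p t * ln (p1' (g1 t) * p2' (g2 t)))).
  apply: gibbs => //.
  - by move=> t; rewrite mulr_ge0// pushfwd_ge0.
  - move=> t /eqP; rewrite mulf_eq0 => /orP[] /eqP p'0;
      apply/eqP; rewrite eq_le p0 andbT -p'0; exact: pushfwd_ge.
  - rewrite p1; have <- : \sum_(u : T1 * T2) p1' u.1 * p2' u.2 = 1.
      rewrite -(pair_bigA _ (fun a b => p1' a * p2' b))/=.
      under eq_bigr do rewrite -mulr_sumr sum1_pushfwd p1 mulr1.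
      by rewrite sum1_pushfwd.
    rewrite -(big_image _ _ (fun t => (g1 t, g2 t)) predT
      (fun u : T1 * T2 => p1' u.1 * p2' u.2)) /=.
    rewrite big_uniq /=; last by rewrite map_inj_uniq ?enum_uniq.
    rewrite [leRHS](bigID (fun u => u \in [seq (g1 t, g2 t) | t in T])) /=.
    by rewrite lerDl sumr_ge0// => u _; rewrite mulr_ge0// pushfwd_ge0.
rewrite /entropy -!sum_pushfwd -opprD lerN2 -big_split /=.
apply: ler_sum => t _; have [->|ptN0] := eqVneq (p t) 0.
  by rewrite !mul0r addr0.
have pt : 0 < p t by rewrite lt_def ptN0 p0.
by rewrite -mulrDr lnM// posrE (lt_le_trans pt)// pushfwd_ge.
Qed.

Lemma entropy_ge0 T (p : T -> R) :
  (forall t, 0 <= p t) -> \sum_t p t = 1 -> 0 <= entropy p.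
Proof.
move=> p0 p1; rewrite oppr_ge0 sumr_le0// => t _.
rewrite mulr_ge0_le0// ln_le0// -p1 (bigD1 t)//= lerDl sumr_ge0//.
Qed.

(* Gibbs' inequality against the measure giving mass 1/2 uniformly to [A] and
   mass at most 1/2 uniformly to the rest. *)
Lemma entropy_le_concentrated T (p : T -> R) (A : {set T}) :
  (forall t, 0 <= p t) -> \sum_t p t = 1 -> (0 < #|A|)%N ->
  entropy p <= ln 2 + ln (#|A|%:R) + (\sum_(t | t \notin A) p t) * ln (#|T|%:R).
Proof.
move=> p0 p1 A0; have T0 : (0 < #|T|)%N by exact: leq_trans A0 (max_card _).
pose q t : R := if t \in A then (2 * #|A|%:R)^-1 else (2 * #|T|%:R)^-1.
have q0 t : 0 < q t by rewrite /q; case: ifP; rewrite invr_gt0 mulr_gt0 ?ltr0n.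
have lnA : 0 <= ln (#|A|%:R : R) by rewrite ln_ge0// ler1n.
have lnT : 0 <= ln (#|T|%:R : R) by rewrite ln_ge0// ler1n.
apply: (@le_trans _ _ (- \sum_t p t * ln (q t))).
  apply: gibbs => // [t|t|]; first exact: ltW.
    by move=> qt0; have := q0 t; rewrite qt0 ltxx.
  rewrite p1 (bigID (mem A))/=.
  under eq_bigr => t tA do rewrite /q tA.
  rewrite sumr_const.
  under [X in _ + X]eq_bigr => t tA do rewrite /q (negbTE tA).
  rewrite sumr_const [leRHS](_ : 1 = 2^-1 + 2^-1)//; last by field.
  rewrite -!(mulr_natr (_^-1)) !invfM -!mulrA lerD//.
    by rewrite mulVf ?mulr1// pnatr_eq0 -lt0n.
  by rewrite ger_pMr ?invr_gt0// ler_pdivrMl ?ltr0n// mulr1 ler_nat max_card.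
rewrite -sumrN (bigID (mem A))/=.
have -> : ln 2 + ln (#|A|%:R) + (\sum_(t | t \notin A) p t) * ln (#|T|%:R) =
  ((\sum_(t in A) p t) * ln 2 + ln (#|A|%:R)) +
  ((\sum_(t | t \notin A) p t) * ln 2 +
    (\sum_(t | t \notin A) p t) * ln (#|T|%:R)) :> R.
  have -> : \sum_(t | t \notin A) p t = 1 - \sum_(t in A) p t.
    by rewrite -p1 [in RHS](bigID (mem A))/= addrAC subrr add0r.
  ring.
apply: lerD.
  have: (\sum_(t in A) p t) * ln (#|A|%:R) <= ln (#|A|%:R).
    rewrite ler_piMl// -p1 [leRHS](bigID (mem A))/= lerDl sumr_ge0//.
  move=> lA; apply: le_trans (lerD (lexx _) lA).
  rewrite -mulrDr mulr_suml ler_sum// => t tA.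
  by rewrite /q tA lnV ?posrE ?mulr_gt0 ?ltr0n// lnM ?posrE ?ltr0n// mulrN opprK.
rewrite -mulrDr mulr_suml ler_sum// => t tA.
rewrite /q (negbTE tA) lnV ?posrE ?mulr_gt0 ?ltr0n// lnM ?posrE ?ltr0n//.
by rewrite mulrN opprK.
Qed.

Lemma entropy_le_card T (p : T -> R) :
  (forall t, 0 <= p t) -> \sum_t p t = 1 -> entropy p <= ln (#|T|%:R).
Proof.
move=> p0 p1.
have T0 : (0 < #|T|)%N.
  rewrite lt0n; apply/eqP => T0; suff : (0 : R) = 1 by move/eqP; rewrite eq_sym oner_eq0.
  rewrite -p1 big1// => t _; exfalso; have := fintype0 t; exact.
apply: (@le_trans _ _ (- \sum_t p t * ln (#|T|%:R^-1))).
  apply: gibbs => //; rewrite ?invr_ge0//.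
    by move=> t /eqP; rewrite invr_eq0 pnatr_eq0 eqn0Ngt T0.
  by rewrite sumr_const -(mulr_natr (_^-1)) mulVf ?p1// pnatr_eq0 -lt0n.
by rewrite -mulr_suml p1 mul1r lnV ?opprK// posrE ltr0n.
Qed.

(** Gibbs' inequality for each [p i] against the common average; the cross entropies add up to [N]
    times the entropy of the average. *)
Lemma entropy_concave T (N : nat) (p : 'I_N -> T -> R) :
  (forall i t, 0 <= p i t) -> (forall i, \sum_t p i t = 1) -> (0 < N)%N ->
  \sum_i entropy (p i) <=
    N%:R * entropy (fun t => N%:R^-1 * \sum_i p i t).
Proof.
move=> p0 p1 N0; set pb : T -> R := fun t => _ * _.
have NN : (N%:R : R) != 0 by rewrite pnatr_eq0 -lt0n.
rewrite /entropy mulrN mulr_sumr.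
have -> : \sum_t N%:R * (pb t * ln (pb t)) = \sum_i \sum_t p i t * ln (pb t).
  rewrite exchange_big/=; apply: eq_bigr => t _.
  by rewrite -mulr_suml mulrA; congr (_ * _); rewrite /pb mulVKf.
rewrite -sumrN; apply: ler_sum => i _; apply: gibbs => //.
- by move=> t; rewrite mulr_ge0 ?invr_ge0// sumr_ge0.
- move=> t /eqP; rewrite mulf_eq0 invr_eq0 (negbTE NN)/= => /eqP s0.
  apply/eqP; rewrite eq_le p0 andbT -s0 (bigD1 i)//= lerDl sumr_ge0//.
- rewrite p1 -mulr_sumr exchange_big/=.
  by under eq_bigr do rewrite p1; rewrite sumr_const card_ord mulVf.
Qed.

End FiniteEntropy.

(** * Block entropies: cutting long itineraries into blocks of fixed length *)

Section Telescoping.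
Context {R : realType} (h : nat -> nat -> R) (C : R).
Hypothesis C0 : 0 <= C.
Hypothesis h_ge0 : forall a n, 0 <= h a n.
Hypothesis h_le : forall a n, h a n <= n%:R * C.
Hypothesis h_sub : forall a n m, h a (n + m) <= h a n + h (a + n) m.

(* With [T j = h j (n - j)], the window sums [W j = T j + .. + T (j + q - 1)]
   telescope: [W j - W (j + 1) = T j - T (j + q) <= h j q]. *)
Lemma block_subadditive q n :
  q%:R * h 0 n <= \sum_(p < n) h p q + 2 * q%:R ^+ 2 * C.
Proof.
have sge0 m : 0 <= \sum_(p < m) h p q by exact: sumr_ge0.
have [nq|qn] := ltnP n q.
  apply: (@le_trans _ _ (q%:R * (q%:R * C))).
    rewrite ler_wpM2l// (le_trans (h_le _ _))// ler_wpM2r// ler_nat ltnW//.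
  rewrite -[leLHS]add0r lerD// mulrA -expr2 ler_wpM2r// ler_peMl ?exprn_ge0//.
  by rewrite ler1n.
pose W j := \sum_(i < q) h (j + i) (n - (j + i)).
have Wstep j : (j + q <= n)%N -> W j <= h j q + W j.+1.
  move=> jq; case: q @W jq {qn sge0} => [|q] W jq.
    by rewrite /W !big_ord0 addr0.
  rewrite /W [in leLHS]big_ord_recl [in leRHS]big_ord_recr /= addn0.
  rewrite [leLHS]addrC [leRHS]addrCA lerD//.
  2: { have -> : (n - j = q.+1 + (n - (j.+1 + q)))%N by lia.
       have -> : (j.+1 + q = j + q.+1)%N by lia.
       rewrite (le_trans (h_sub _ _ _))//. }
  rewrite le_eqVlt; apply/orP; left; apply/eqP; apply: eq_bigr => i _.
  by rewrite /bump/= add1n addnS addSn.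
have Wsum j : (j + q <= n)%N -> W 0 <= \sum_(p < j) h p q + W j.
  elim: j => [|j IH] jq; first by rewrite big_ord0 add0r.
  rewrite (le_trans (IH _))//; first by lia.
  by rewrite big_ord_recr/= -addrA lerD2l Wstep//; lia.
(* At [j = n - q] the window consists of [q] tails of length at most [q] each. *)
have Wlast : W (n - q)%N <= q%:R ^+ 2 * C.
  apply: (@le_trans _ _ (\sum_(i < q) q%:R * C)).
    apply: ler_sum => i _; rewrite (le_trans (h_le _ _))// ler_wpM2r//.
    by rewrite ler_nat; lia.
  by rewrite sumr_const card_ord -[_ * C *+ _]mulr_natl mulrA -expr2.
(* The block is cut at each of the [q] offsets [i < q], and the head costs at most [q * C]. The
   errors [q ^+ 2 * C] at the start and at the end give the factor 2. *)
have W0 : q%:R * h 0 n <= W 0 + q%:R ^+ 2 * C.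
  rewrite mulr_natl -[X in h 0 n *+ X](card_ord q) -sumr_const.
  apply: (@le_trans _ _ (\sum_(i < q) (h i (n - i) + q%:R * C))).
    apply: ler_sum => i _.
    have -> : n = (i + (n - i))%N :> nat by have := ltn_ord i; lia.
    rewrite (le_trans (h_sub _ _ _))// add0n addrC.
    have -> : (i + (n - i) - i = n - i)%N by lia.
    by rewrite lerD2l (le_trans (h_le _ _))// ler_wpM2r// ler_nat ltnW.
  rewrite big_split/= sumr_const card_ord -[_ * C *+ _]mulr_natl mulrA -expr2 lerD2r.
  by rewrite /W; under [leRHS]eq_bigr do rewrite add0n.
have := Wsum (n - q)%N; rewrite subnK// => /(_ (leqnn _)) W0n.
apply: (le_trans W0); apply: (@le_trans _ _ (\sum_(p < n - q) h p q + q%:R ^+ 2 * C + q%:R ^+ 2 * C)).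
  by rewrite lerD2r (le_trans W0n)// lerD2l.
have -> : 2 * q%:R ^+ 2 * C = q%:R ^+ 2 * C + q%:R ^+ 2 * C by ring.
rewrite addrA !lerD2r.
rewrite -!(big_mkord xpredT (fun p => h p q)).
by rewrite [leRHS](@big_cat_nat _ _ _ (n - q)%N)/= ?leq_subr// lerDl sumr_ge0.
Qed.

End Telescoping.

Section Content.
Context {d : measure_display} {X : measurableType d} {R : realType}.
Implicit Types (P : set X -> R) (T : finType).

(** Only finite additivity is asked, so that the entropy estimates serve both [prob mu] and weighted
    sums of point masses. *)
Definition fa_prob P := [/\ forall A, measurable A -> 0 <= P A, P setT = 1 &
  forall A B, measurable A -> measurable B -> A `&` B = set0 ->
    P (A `|` B) = P A + P B].

Definition law (T : eqType) P (L : X -> T) (t : T) : R := P (L @^-1` [set t]).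

Definition measurable_label (T : eqType) (L : X -> T) :=
  forall t, measurable (L @^-1` [set t]).

Lemma fa_prob0 P : fa_prob P -> P set0 = 0.
Proof.
move=> [_ _ PU]; have := PU set0 set0 measurable0 measurable0 (setI0 _).
by rewrite setU0 => /eqP; rewrite -subr_eq subrr => /eqP.
Qed.

Lemma fa_prob_le P A B : fa_prob P -> measurable A -> measurable B ->
  A `<=` B -> P A <= P B.
Proof.
move=> [P0 _ PU] mA mB AB; rewrite -(setDUK AB) PU//.
- by rewrite lerDl P0//; exact: measurableD.
- exact: measurableD.
- by rewrite setDIK.
Qed.

Lemma label_preimage (T : eqType) P (L : X -> T) (s : seq T) : fa_prob P ->
  measurable_label L -> uniq s ->
  measurable (L @^-1` [set` s]) /\ P (L @^-1` [set` s]) = \sum_(t <- s) law P L t.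
Proof.
move=> cP mL; elim: s => [|t s IH] /=.
  rewrite big_nil (_ : L @^-1` _ = set0) ?fa_prob0//.
  by rewrite -subset0 => x.
move=> /andP[ts us]; have [ms es] := IH us.
have -> : L @^-1` [set` t :: s] = L @^-1` [set t] `|` L @^-1` [set` s].
  apply/seteqP; split => x /=; rewrite inE.
    by move=> /orP[/eqP|]; [left|right].
  by move=> [->|->]; rewrite ?eqxx ?orbT.
split; first exact: measurableU.
case: (cP) => _ _ ->//; first by rewrite big_cons es.
by rewrite -subset0 => x /= [-> ]; apply/negP.
Qed.

Lemma measurable_label_preimage T (L : X -> T) (A : set T) :
  measurable_label L -> measurable (L @^-1` A).
Proof.
move=> mL; rewrite (_ : L @^-1` A = \bigcup_(t in A) (L @^-1` [set t])).
  by apply: fin_bigcup_measurable => // t _; exact: mL.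
by apply/seteqP; split => [x Ax|x [t At /= xt]]; [exists (L x)|rewrite /= xt].
Qed.

Lemma sum_law T P (L : X -> T) (A : pred T) : fa_prob P -> measurable_label L ->
  \sum_(t | A t) law P L t = P (L @^-1` [set t | A t]).
Proof.
move=> cP mL; rewrite -big_filter.
have [_ <-] := label_preimage cP mL (filter_uniq A (index_enum_uniq T)).
congr P; apply/seteqP; split => x /=; rewrite mem_filter mem_index_enum andbT//.
Qed.

Lemma pushfwd_law T T' P (g : T -> T') (L : X -> T) : fa_prob P ->
  measurable_label L -> pushfwd g (law P L) = law P (g \o L).
Proof.
move=> cP mL; apply/funext => t'; rewrite /pushfwd sum_law// /law.
by congr P; apply/seteqP; split => x /= /eqP.
Qed.

Lemma law_ge0 T P (L : X -> T) t : fa_prob P -> measurable_label L ->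
  0 <= law P L t.
Proof. by move=> [P0 _ _] mL; exact: P0. Qed.

Lemma law_sum1 T P (L : X -> T) : fa_prob P -> measurable_label L ->
  \sum_t law P L t = 1.
Proof.
move=> cP mL; rewrite sum_law//; case: cP => _ <- _.
by congr P; apply/seteqP; split.
Qed.

Variables (f : X -> X) (k : nat) (xi : X -> 'I_k).
Hypotheses (mf : forall A, measurable A -> measurable (f @^-1` A))
  (mxi : measurable_label xi).

Definition itinerary (a n : nat) (x : X) : {ffun 'I_n -> 'I_k} :=
  [ffun i : 'I_n => xi (iter (a + i) f x)].

(** The starting time [a] is kept because weighted point masses are not invariant; under an
    invariant measure the value does not depend on it. *)
Definition block_entropy P a n := entropy (law P (itinerary a n)).

Lemma measurable_iter n A : measurable A -> measurable (iter n f @^-1` A).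
Proof.
elim: n A => [|n IH] A mA//.
by rewrite (_ : iter n.+1 f = f \o iter n f)// comp_preimage; exact/IH/mf.
Qed.

Lemma measurable_itinerary a n : measurable_label (itinerary a n).
Proof.
move=> s; rewrite (_ : _ @^-1` _ =
    \bigcap_(i : 'I_n) (iter (a + i) f @^-1` (xi @^-1` [set s i]))).
  by apply: fin_bigcap_measurable => // i _; exact/measurable_iter/mxi.
apply/seteqP; split => x /= => [<- i _|xs]; rewrite ?ffunE//.
by apply/ffunP => i; rewrite ffunE; exact: xs.
Qed.

Lemma block_entropy_ge0 P a n : fa_prob P -> 0 <= block_entropy P a n.
Proof.
move=> cP; have mi := @measurable_itinerary a n.
by apply: entropy_ge0 => [t|]; [exact: law_ge0|exact: law_sum1].
Qed.

Lemma block_entropy_le P a n : fa_prob P -> (0 < k)%N ->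
  block_entropy P a n <= n%:R * ln k%:R.
Proof.
move=> cP k0; have mi := @measurable_itinerary a n.
apply: le_trans (entropy_le_card _ _) _.
- by move=> t; exact: law_ge0.
- exact: law_sum1.
- by rewrite card_ffun !card_ord natrX lnXn ?ltr0n// mulr_natl.
Qed.

Lemma block_entropyD P a n m : fa_prob P ->
  block_entropy P a (n + m) <= block_entropy P a n + block_entropy P (a + n) m.
Proof.
move=> cP; have mi := @measurable_itinerary a (n + m)%N.
pose g1 (s : {ffun 'I_(n + m) -> 'I_k}) : {ffun 'I_n -> 'I_k} :=
  [ffun i => s (lshift m i)].
pose g2 (s : {ffun 'I_(n + m) -> 'I_k}) : {ffun 'I_m -> 'I_k} :=
  [ffun i => s (rshift n i)].
have ginj : injective (fun s => (g1 s, g2 s)).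
  move=> s s' [/ffunP e1 /ffunP e2]; apply/ffunP => i.
  case: (split_ordP i) => j ->.
    by have := e1 j; rewrite !ffunE.
  by have := e2 j; rewrite !ffunE.
have := @entropy_subadditive R _ _ _ g1 g2 (law P (itinerary a (n + m))) ginj.
rewrite !pushfwd_law// => H; apply: le_trans (H _ _) _.
- by move=> t; exact: law_ge0.
- exact: law_sum1.
- rewrite /block_entropy (_ : g1 \o _ = itinerary a n).
    rewrite (_ : g2 \o _ = itinerary (a + n) m)//.
    by apply/funext => x; apply/ffunP => i; rewrite !ffunE/= addnA.
  by apply/funext => x; apply/ffunP => i; rewrite !ffunE.
Qed.

Lemma block_entropy_telescope P q n : fa_prob P -> (0 < k)%N ->
  q%:R * block_entropy P 0 n <=
  \sum_(p < n) block_entropy P p q + 2 * q%:R ^+ 2 * ln k%:R.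
Proof.
move=> cP k0; apply: (@block_subadditive R (block_entropy P)).
- by rewrite ln_ge0// ler1n.
- by move=> a m; exact: block_entropy_ge0.
- by move=> a m; exact: block_entropy_le.
- by move=> a m m'; exact: block_entropyD.
Qed.

Lemma block_entropy_shift P p q :
  block_entropy P p q = block_entropy (fun A => P (iter p f @^-1` A)) 0 q.
Proof.
rewrite /block_entropy; congr entropy; apply/funext => s; rewrite /law.
congr P; apply/seteqP; split => x /= <-; apply/ffunP => i; rewrite !ffunE//.
  by rewrite add0n addnC iterD.
by rewrite add0n addnC iterD.
Qed.

End Content.

(** * From a finitely additive content on a compact metric space to a Borel probability *)

Section ContentToMeasure.
Context {R : realType} {X : pmetricType R}.
Hypothesis X_compact : compact [set: X].
Variable lam : set X -> R.
Hypothesis lam_ge0 : forall A, 0 <= lam A.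
Hypothesis lamT : lam setT = 1.
Hypothesis lamU : forall A B, A `&` B = set0 -> lam (A `|` B) = lam A + lam B.

Let lam_le A B : A `<=` B -> lam A <= lam B.
Proof. by move=> AB; rewrite -(setDUK AB) lamU ?lerDl// setDIK. Qed.

Let lam0 : lam set0 = 0.
Proof.
by apply: (addrI (lam set0)); rewrite -lamU ?setU0 ?addr0// setI0.
Qed.

Let lamU_le A B : lam (A `|` B) <= lam A + lam B.
Proof.
have -> : A `|` B = A `|` (B `\` A) by rewrite setUDr setDv setD0.
rewrite lamU ?setDIK// lerD2l; by apply: lam_le => x [].
Qed.

(** [lam] need not be countably additive. Approximation from inside by closed, hence compact, sets
    restores countable subadditivity on open sets, possibly lowering the values. *)
Definition inner_content (U : set X) : \bar R :=
  ereal_sup [set (lam K)%:E | K in [set K | closed K /\ K `<=` U]].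

Let tau := inner_content.

Let tau_ge K U : closed K -> K `<=` U -> ((lam K)%:E <= tau U)%E.
Proof. by move=> cK KU; apply: ereal_sup_ubound; exists K. Qed.

Let tau_le_lam U : (tau U <= (lam U)%:E)%E.
Proof. by apply: ge_ereal_sup => _ [K [_ KU] <-]; rewrite lee_fin lam_le. Qed.

Let tau_ge0 U : (0 <= tau U)%E.
Proof. by apply: (le_trans _ (@tau_ge set0 U closed0 _)); rewrite ?lam0. Qed.

Let tau_le U V : U `<=` V -> (tau U <= tau V)%E.
Proof.
move=> UV; apply: ge_ereal_sup => _ [K [cK KU] <-].
by apply: tau_ge => //; exact: subset_trans UV.
Qed.

Let tau_fin U : tau U \is a fin_num.
Proof.
rewrite ge0_fin_numE ?tau_ge0//; exact: le_lt_trans (tau_le_lam U) (ltry _).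
Qed.

(** Normality separates [K] minus [U] and [K] minus [V] by disjoint open sets [A] and [B]; then [K]
    minus [A] and [K] minus [B] are closed, cover [K], and lie in [U] and [V]. *)
Let tauU U V : open U -> open V -> (tau (U `|` V) <= tau U + tau V)%E.
Proof.
move=> oU oV; apply: ge_ereal_sup => _ [K [cK KUV] <-].
have /normal_openP nX : normal_space X := pseudometric_normal.
have [|||A [B [oA oB KUA KVB AB]]] 
  := nX R (K `\` U) (K `\` V).
- by rewrite setDE; apply: closedI => //; exact: open_closedC.
- by rewrite setDE; apply: closedI => //; exact: open_closedC.
- by rewrite -subset0 => x [[Kx nUx] [_ nVx]]; case: (KUV x Kx).
have KAB : K `<=` (K `\` A) `|` (K `\` B).
  move=> x Kx; have [Ax|] := pselect (A x); last by left.
  right; split => // Bx; have : (A `&` B) x by split.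
  by rewrite AB.
apply: (@le_trans _ _ (lam (K `\` A) + lam (K `\` B))%:E).
  by rewrite lee_fin (le_trans (lam_le KAB)).
rewrite EFinD leeD// tau_ge//; try by rewrite setDE; apply: closedI => //; exact: open_closedC.
  by move=> x [Kx nAx]; apply: contrapT => nUx; apply: nAx; apply: KUA.
by move=> x [Kx nAx]; apply: contrapT => nUx; apply: nAx; apply: KVB.
Qed.

Let tau_bigcup (U : (set X)^nat) : (forall n, open (U n)) ->
  (tau (\bigcup_n U n) <= \sum_(n <oo) tau (U n))%E.
Proof.
move=> oU; pose V n := \bigcup_(i < n) U i.
have oV n : open (V n) by exact: bigcup_open.
have tauV n : (tau (V n) <= \sum_(0 <= i < n) tau (U i))%E.
  elim: n => [|n IH].
    rewrite big_nil /V bigcup_mkord big_ord0.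
    apply: ge_ereal_sup => _ [K [_ K0] <-].
    by move: K0; rewrite subset0 => ->; rewrite lam0.
  rewrite big_nat_recr//= (_ : V n.+1 = V n `|` U n).
    by rewrite (le_trans (tauU _ _))// leeD2r.
  by rewrite /V !bigcup_mkord big_ord_recr.
apply: ge_ereal_sup => _ [K [cK KU] <-].
have kK : compact K by apply: subclosed_compact cK X_compact _.
move: kK; rewrite compact_cover => kK.
have [|D _ KD] := kK nat setT V (fun n _ => oV n).
  by move=> x /KU [n _ Ux]; exists n.+1 => //; exists n => /=.
pose N := \max_(i <- finmap.enum_fset D) i.
have KVN : K `<=` V N.
  move=> x /KD [n /= nD [i /= ni Ux]]; exists i => //=.
  by rewrite (leq_trans ni)// /N; apply: leq_bigmax_seq.
apply: le_trans (tau_ge cK KVN) _; apply: le_trans (tauV N) _.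
apply: (@nneseries_lim_ge _ _ xpredT) => n _ _; exact: tau_ge0.
Qed.

Definition outer_content (A : set X) : \bar R :=
  ereal_inf [set inner_content U | U in [set U | open U /\ A `<=` U]].

Let mu := outer_content.

Let mu_le_tau A U : open U -> A `<=` U -> (mu A <= tau U)%E.
Proof. by move=> oU AU; apply: ereal_inf_lbound; exists U. Qed.

Let mu_open U : open U -> mu U = tau U.
Proof.
move=> oU; apply/eqP; rewrite eq_le mu_le_tau//=.
by apply: le_ereal_inf_tmp => _ [V [oV UV] <-]; exact: tau_le.
Qed.

Lemma outer_content_ge0 A : (0 <= mu A)%E.
Proof. by apply: le_ereal_inf_tmp => _ [V [oV UV] <-]; exact: tau_ge0. Qed.

Lemma outer_content0 : mu set0 = 0%E.
Proof.
apply/eqP; rewrite eq_le outer_content_ge0 andbT mu_open; last exact: open0.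
by rewrite (le_trans (tau_le_lam _))// lam0.
Qed.

Lemma le_outer_content : {homo mu : A B / A `<=` B >-> (A <= B)%E}.
Proof.
move=> A B AB; apply: le_ereal_inf_tmp => _ [V [oV UV] <-].
by apply: mu_le_tau => //; exact: subset_trans UV.
Qed.

Let mu_fin A : mu A \is a fin_num.
Proof.
rewrite ge0_fin_numE ?outer_content_ge0//.
apply: le_lt_trans (@mu_le_tau A setT openT _) _ => //.
by rewrite -ge0_fin_numE ?tau_fin ?tau_ge0.
Qed.

Let mu_adherent A (e : R) : 0 < e ->
  exists U, [/\ open U, A `<=` U & (tau U <= mu A + e%:E)%E].
Proof.
move=> e0; have [_ [U [oU AU] <-] lt] := lb_ereal_inf_adherent e0 (mu_fin A).
by exists U; split => //; exact: ltW.
Qed.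

Lemma outer_content_sigma_subadditive : sigma_subadditive mu.
Proof.
move=> F; apply/lee_addgt0Pr => e e0.
rewrite (le_trans _ (epsilon_trick _ _ (ltW e0)))//; last first.
  by move=> n; exact: outer_content_ge0.
have e_gt0 n : 0 < e / (2 ^ n.+1)%:R by rewrite divr_gt0// ltr0n expn_gt0.
have /choice[G PG] := fun n => mu_adherent (F n) (e_gt0 n).
have oG : open (\bigcup_n G n) by apply: bigcup_open => n _; have [] := PG n.
apply: (@le_trans _ _ (tau (\bigcup_n G n))).
  apply: mu_le_tau => // x [n _ Fx]; exists n => //.
  by have [_ + _] := PG n; exact.
apply: le_trans (tau_bigcup _) _; first by move=> n; have [] := PG n.
apply: lee_nneseries => n _; last by have [] := PG n.
by move=> _; exact: tau_ge0.
Qed.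

HB.instance Definition _ := isOuterMeasure.Build R X outer_content
  outer_content0 outer_content_ge0 le_outer_content
  outer_content_sigma_subadditive.

Let tau_adherent U (e : R) : 0 < e ->
  exists K, [/\ closed K, K `<=` U & (tau U <= (lam K + e)%:E)%E].
Proof.
move=> e0; have [_ [K [cK KU] <-] lt] := ub_ereal_sup_adherent e0 (tau_fin U).
exists K; split => //; rewrite EFinD -leeBlDr//; exact: ltW.
Qed.

(** Choose [K] almost optimal in the intersection of [V] and [U], then [L] almost optimal in [V]
    minus [K]: these are disjoint closed subsets of [V], so additivity of [lam] bounds the sum of
    both parts by [tau V]. The thirds of [e] pay for the choices of [V], [K] and [L]. *)
Lemma open_caratheodory U : open U -> outer_content.-caratheodory U.
Proof.
move=> oU; apply: le_caratheodory_measurable => A.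
apply/lee_addgt0Pr => e e0.
have e3 : 0 < e / 3 by rewrite divr_gt0.
have [V [oV AV muA]] := mu_adherent A e3.
have [K [cK KUV tauK]] := tau_adherent (V `&` U) e3.
have [L [cL LV tauL]] := tau_adherent (V `\` K) e3.
have KL0 : K `&` L = set0.
  by rewrite -subset0 => x [Kx /LV[]].
apply: (@le_trans _ _ (tau (V `&` U) + tau (V `\` K))%E).
  apply: leeD; apply: mu_le_tau.
  - exact: openI.
  - exact: setSI.
  - by rewrite setDE; apply: openI => //; exact: closed_openC.
  - move=> x [Ax nUx]; split; first exact: AV.
    by move=> /KUV[].
apply: (@le_trans _ _ ((lam K + lam L)%:E + (e/3 + e/3)%:E)%E).
  by rewrite -EFinD addrACA EFinD leeD.
apply: (@le_trans _ _ (tau V + (e/3 + e/3)%:E)%E).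
  rewrite leeD2r// -lamU// tau_ge//; first exact: closedU.
  by rewrite subUset; split; [apply: subset_trans KUV _|apply: subset_trans LV _]; exact: subIsetl.
apply: (@le_trans _ _ (mu A + (e/3)%:E + (e/3 + e/3)%:E)%E).
  by rewrite leeD2r.
by rewrite -addeA -EFinD leeD2l// lee_fin le_eqVlt; apply/orP; left; apply/eqP; field.
Qed.

Lemma borel_caratheodory (A : set (borel X)) :
  measurable A -> outer_content.-caratheodory A.
Proof.
apply: smallest_sub; last exact: open_caratheodory.
split.
- exact: (caratheodory_measurable_set0 outer_content).
- move=> B; rewrite setTD; exact: (@caratheodory_measurable_setC _ _ outer_content).
- move=> F; exact: (@caratheodory_measurable_bigcup _ _ outer_content).
Qed.

Definition content_measure (A : set (borel X)) : \bar R := outer_content A.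

Lemma content_measure_sigma_additive : semi_sigma_additive content_measure.
Proof.
move=> F mF tF mUF.
apply: (@caratheodory_measure_sigma_additive R X outer_content F) => //.
  by move=> i; exact: borel_caratheodory.
exact: borel_caratheodory.
Qed.

HB.instance Definition _ := isMeasure.Build _ (borel X) R content_measure
  outer_content0 outer_content_ge0 content_measure_sigma_additive.

Lemma content_measureT : content_measure setT = 1%E.
Proof.
transitivity (tau setT); first exact: mu_open openT.
apply/eqP; rewrite eq_le (le_trans (tau_le_lam _)) ?lamT//=.
by rewrite -lamT; apply: tau_ge => //; exact: closedT.
Qed.

HB.instance Definition _ := @Measure_isProbability.Build _ _ _ content_measure
  content_measureT.

(** The formula on open sets expresses [mu] through [lam]; the invariance of [mu] is later read off
    it. *)
Lemma content_to_probability : exists mu : probability (borel X) R,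
  (forall U : set X, open U -> mu U = inner_content U) /\
  (forall K : set X, closed K -> ((lam K)%:E <= mu K)%E).
Proof.
exists content_measure; split; first exact: mu_open.
move=> K cK; apply: le_ereal_inf_tmp => _ [V [oV KV] <-]; exact: tau_ge.
Qed.

End ContentToMeasure.

(** * Means of bounded functions and an ergodic theorem in probability *)

Section BoundedMean.
Context {R : realType} {X : pmetricType R} (mu : probability (borel X) R).
Implicit Types g h : borel X -> R.

Definition bounded_measurable g :=
  measurable_fun setT g /\ exists M, forall x, `|g x| <= M.

Definition prob (A : set (borel X)) : R := fine (mu A).

Lemma probE A : measurable A -> mu A = (prob A)%:E.
Proof. by move=> mA; rewrite /prob fineK// fin_num_measure. Qed.

Lemma prob_fa_prob : fa_prob prob.
Proof.
split=> [A mA||A B mA mB AB]; first by rewrite fine_ge0.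
  by rewrite /prob probability_setT.
by apply: EFin_inj; rewrite EFinD -!probE//; [exact: measureU|exact: measurableU].
Qed.

Lemma measurable_le_cst g c : measurable_fun setT g ->
  measurable ([set x | g x <= c] : set (borel X)).
Proof.
move=> mg; rewrite (_ : [set x | _] = setT `&` g @^-1` `]-oo, c]%classic).
  exact: (mg measurableT _ (measurable_itv _)).
by rewrite setTI; apply/seteqP; split=> x /=; rewrite in_itv.
Qed.

Lemma measurable_gt_cst g c : measurable_fun setT g ->
  measurable ([set x | c < g x] : set (borel X)).
Proof.
move=> mg; rewrite (_ : [set x | _] = setT `&` g @^-1` `]c, +oo[%classic).
  exact: (mg measurableT _ (measurable_itv _)).
by rewrite setTI; apply/seteqP; split=> x /=; rewrite in_itv/= andbT.
Qed.

Lemma bounded_integrable g : bounded_measurable g ->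
  mu.-integrable setT (EFin \o g).
Proof.
move=> [mg [M gM]]; apply: measurable_bounded_integrable => //.
  by rewrite -ge0_fin_numE ?fin_num_measure.
exists M; split; first exact: num_real.
by move=> y My x _ /=; rewrite (le_trans (gM x))// ltW.
Qed.

Lemma bounded_measurableD g h : bounded_measurable g -> bounded_measurable h ->
  bounded_measurable (g \+ h).
Proof.
move=> [mg [M gM]] [mh [M' hM']]; split; first exact: measurable_funD.
by exists (M + M') => x; rewrite (le_trans (ler_normD _ _))// lerD.
Qed.

Lemma bounded_measurableZ g c : bounded_measurable g ->
  bounded_measurable (fun x => c * g x).
Proof.
move=> [mg [M gM]]; split; first exact: measurable_funM.
by exists (`|c| * M) => x; rewrite normrM ler_wpM2l.
Qed.

Lemma bounded_measurable_cst c : bounded_measurable (fun=> c).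
Proof. by split; [exact: measurable_cst|exists `|c|]. Qed.

Lemma bounded_measurable_indic (A : set (borel X)) : measurable A ->
  bounded_measurable \1_A.
Proof.
move=> mA; split; first exact: measurable_indic.
by exists 1 => x; rewrite indicE; case: (_ \in _); rewrite ?normr1 ?normr0.
Qed.

Lemma bounded_measurable_max g h : bounded_measurable g -> bounded_measurable h ->
  bounded_measurable (g \max h).
Proof.
move=> [mg [M gM]] [mh [M' hM']]; split; first exact: measurable_maxr.
exists (Num.max M M') => x; rewrite /= maxEle; case: ifP => _.
  by rewrite (le_trans (hM' x))// le_max lexx orbT.
by rewrite (le_trans (gM x))// le_max lexx.
Qed.

Lemma bounded_measurable_sum I (s : seq I) (g : I -> borel X -> R) :
  (forall i, bounded_measurable (g i)) ->
  bounded_measurable (fun x => \sum_(i <- s) g i x).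
Proof.
move=> bg; elim: s => [|i s IH].
  rewrite (_ : (fun _ => _) = fun=> 0); first exact: bounded_measurable_cst.
  by apply/funext => x; rewrite big_nil.
rewrite (_ : (fun _ => _) = g i \+ (fun x => \sum_(j <- s) g j x)).
  exact: bounded_measurableD.
by apply/funext => x; rewrite big_cons.
Qed.

Lemma meanD g h : bounded_measurable g -> bounded_measurable h ->
  mean mu (g \+ h) = mean mu g + mean mu h.
Proof.
by move=> bg bh; apply: RintegralD => //; exact: bounded_integrable.
Qed.

Lemma meanZ g c : bounded_measurable g -> mean mu (fun x => c * g x) = c * mean mu g.
Proof. by move=> bg; apply: RintegralZl => //; exact: bounded_integrable. Qed.

Lemma mean_cst c : mean mu (fun=> c) = c.
Proof. by rewrite /mean Rintegral_cst//= (@probability_setT _ _ _ mu) mulr1. Qed.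

Lemma mean_le g h : bounded_measurable g -> bounded_measurable h ->
  (forall x, g x <= h x) -> mean mu g <= mean mu h.
Proof.
by move=> bg bh gh; apply: le_Rintegral => //; exact: bounded_integrable.
Qed.

Lemma mean_sum I (s : seq I) (g : I -> borel X -> R) :
  (forall i, bounded_measurable (g i)) ->
  mean mu (fun x => \sum_(i <- s) g i x) = \sum_(i <- s) mean mu (g i).
Proof.
move=> bg; elim: s => [|i s IH].
  rewrite (_ : (fun _ => _) = fun=> 0) ?mean_cst ?big_nil//.
  by apply/funext => x; rewrite big_nil.
rewrite big_cons -IH -meanD//; last exact: bounded_measurable_sum.
by congr mean; apply/funext => x; rewrite big_cons.
Qed.

Lemma mean_indic (A : set (borel X)) : measurable A -> mean mu \1_A = prob A.
Proof.
by move=> mA; rewrite /mean /Rintegral integral_indic// setIT.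
Qed.

Lemma prob_nonincreasing (F : (set (borel X))^nat) e :
  (forall n, measurable (F n)) -> (forall n, F n.+1 `<=` F n) ->
  prob (\bigcap_n F n) = 0 -> 0 < e -> exists N, forall n, (N <= n)%N -> prob (F n) <= e.
Proof.
move=> mF dF F0 e0.
have : (mu \o F) @ \oo --> mu (\bigcap_n F n).
  apply: nonincreasing_cvg_mu => //.
  - by rewrite -ge0_fin_numE ?fin_num_measure.
  - exact: bigcapT_measurable.
  - by apply/nonincreasing_seqP => n; apply/subsetPset.
rewrite probE ?F0; last exact: bigcapT_measurable.
move=> /fine_cvgP[_] /cvgrPdist_le /(_ e e0) [N _ H].
exists N => n Nn; have := H n Nn; rewrite /= sub0r normrN ger0_norm//.
by rewrite fine_ge0.
Qed.

Section Invariant.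
Variable f : X -> X.
Hypothesis mf : forall A : set (borel X), measurable A -> measurable (f @^-1` A : set (borel X)).
Hypothesis imu : invariant_measure f mu.

Let mff : measurable_fun setT (f : borel X -> borel X).
Proof. by move=> _ A mA; rewrite setTI; exact: mf. Qed.

Lemma bounded_measurable_comp g : bounded_measurable g ->
  bounded_measurable (g \o f).
Proof.
move=> [mg [M gM]]; split; last by exists M => x /=.
exact: measurableT_comp mg mff.
Qed.

Lemma mean_comp g : bounded_measurable g -> mean mu (g \o f) = mean mu g.
Proof.
move=> bg; rewrite /mean /Rintegral; congr fine.
rewrite -(@integral_pushforward _ _ _ _ _ (f : borel X -> borel X) mff mu setT (EFin \o g)) //.
- apply: eq_measure_integral => A mA _.
  exact: imu.
- by apply/measurable_EFinP; case: bg.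
- by rewrite preimage_setT; exact: (bounded_integrable (bounded_measurable_comp bg)).
Qed.

Lemma bounded_birkhoff g n : bounded_measurable g ->
  bounded_measurable (birkhoff f g n).
Proof.
move=> bg; apply: bounded_measurable_sum => i.
elim: (nat_of_ord i) => [//|j IH].
rewrite (_ : (fun _ => _) = (fun x => g (iter j f x)) \o f).
  exact: bounded_measurable_comp.
by apply/funext => x /=; rewrite -iterSr.
Qed.

(** This is max(0, S_1 h, ..., S_n h); the recursion makes the comparison with the value at [f x]
    immediate. *)
Fixpoint maximal_sum (h : borel X -> R) (n : nat) : borel X -> R :=
  if n is n'.+1 then fun x => Num.max 0 (h x + maximal_sum h n' (f x)) else fun=> 0.

Lemma birkhoffS (h : X -> R) n x :
  birkhoff f h n.+1 x = h x + birkhoff f h n (f x).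
Proof.
rewrite /birkhoff big_ord_recl; congr (_ + _).
by apply: eq_bigr => i _; rewrite /bump/= -iterSr.
Qed.

Lemma maximal_sum_ge0 h n x : 0 <= maximal_sum h n x.
Proof. by case: n => [|n] //=; rewrite le_max lexx. Qed.

Lemma maximal_sum_nd h n x : maximal_sum h n x <= maximal_sum h n.+1 x.
Proof.
elim: n x => [|n IH] x; first exact: maximal_sum_ge0.
by rewrite /= ge_max !le_max lexx/= lerD2l; apply/orP; right; exact: IH.
Qed.

Lemma birkhoff_le_maximal_sum h n x : birkhoff f h n x <= maximal_sum h n x.
Proof.
elim: n x => [|n IH] x; first by rewrite /birkhoff big_ord0.
by rewrite birkhoffS /= le_max lerD2l; apply/orP; right; exact: IH.
Qed.

Lemma bounded_maximal_sum h n : bounded_measurable h ->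
  bounded_measurable (maximal_sum h n).
Proof.
move=> bh; elim: n => [|n IH]; first exact: bounded_measurable_cst.
apply: (@bounded_measurable_max (fun=> 0)); first exact: bounded_measurable_cst.
by apply: bounded_measurableD => //; exact: (bounded_measurable_comp IH).
Qed.

(* Garsia: where the maximal partial sum M is positive, h >= M - M o f. *)
Lemma maximal_ergodic h : bounded_measurable h ->
  prob [set x | forall n, birkhoff f h n x <= 0] = 0 -> 0 <= mean mu h.
Proof.
move=> bh P0; case: (bh) => mh [B hB].
pose Z n : set (borel X) := [set x | maximal_sum h n x <= 0].
have mZ n : measurable (Z n).
  have [mM _] := bounded_maximal_sum n bh.
  exact: measurable_le_cst.
have B0 : 0 <= B by apply: le_trans (hB point).
(* With M the maximal sum of order [n.+1], pointwise M <= M o f + h + B * 1_Z: off [Z] this is the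
   recursion, and on [Z] one has M <= 0 <= M o f and h >= -B. Integration cancels M by
   invariance. *)
have main n : 0 <= mean mu h + B * prob (Z n.+1).
  have bM := bounded_maximal_sum n.+1 bh.
  have bMf := bounded_measurable_comp bM.
  have bZ : bounded_measurable (fun x => B * \1_(Z n.+1) x).
    exact/bounded_measurableZ/bounded_measurable_indic.
  have : mean mu (maximal_sum h n.+1) <=
      mean mu ((maximal_sum h n.+1 \o f) \+ (h \+ fun x => B * \1_(Z n.+1) x)).
    apply: mean_le => //.
      by apply: bounded_measurableD => //; exact: bounded_measurableD.
    move=> x /=; rewrite indicE; case: (leP (maximal_sum h n.+1 x) 0) => Mx.
      rewrite mem_set// mulr1 (le_trans Mx)// addr_ge0 ?maximal_sum_ge0//.
        by rewrite le_max lexx.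
      by rewrite -lerBlDr sub0r; have := hB x; rewrite ler_norml => /andP[].
    rewrite memNset; last by rewrite /Z /= => /(lt_le_trans Mx); rewrite ltxx.
    rewrite mulr0 addr0; move: Mx => /=.
    rewrite lt_max ltxx/= => hM; rewrite max_r ?(ltW hM)//.
    by rewrite addrC lerD2r; exact: (maximal_sum_nd h n).
  rewrite meanD//; last exact: bounded_measurableD.
  by rewrite mean_comp// lerDl meanD// meanZ ?mean_indic//; exact: bounded_measurable_indic.
apply/ler_addgt0Pr => e e0.
have [||N HN] := @prob_nonincreasing Z (e / (B + 1)) mZ _ _ (divr_gt0 e0 (ltr_wpDl B0 ltr01)).
- by move=> n x; rewrite /Z /=; exact/le_trans/maximal_sum_nd.
- apply/eqP; rewrite eq_le; apply/andP; split; last first.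
    by rewrite fine_ge0.
  rewrite -P0; apply: (fa_prob_le prob_fa_prob).
  + exact: bigcapT_measurable.
  + rewrite (_ : [set x | _] = \bigcap_n [set x | birkhoff f h n x <= 0]).
      apply: bigcapT_measurable => n.
      have [mS _] := bounded_birkhoff n bh.
      exact: measurable_le_cst.
    by apply/seteqP; split => [x H n _|x H n]; [exact: H|exact: (H n I)].
  + move=> x Zx n /=; rewrite (le_trans (birkhoff_le_maximal_sum _ _ _))//; exact: Zx.
- rewrite (le_trans (main N))// lerD2l.
  rewrite (le_trans (ler_wpM2l B0 (HN N.+1 (leqnSn _))))//.
  rewrite mulrCA ger_pMr// ler_pdivrMr ?mul1r ?lerDl// ltr_wpDl//.
Qed.

Definition frequently_above g a : set (borel X) :=
  [set x | forall N, exists2 n, (N <= n)%N & n%:R * a < birkhoff f g n x].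

(** Dropping the first term changes a Birkhoff sum by a bounded amount, which the gap [a - a']
    absorbs for large [n]. *)
Lemma frequently_above_f g a a' x : bounded_measurable g -> a' < a ->
  frequently_above g a x -> frequently_above g a' (f x).
Proof.
move=> [_ [B hB]] a'a ax N.
have [n] := ax (maxn N (Num.trunc (`|B - a| / (a - a'))).+1).+1.
case: n => // n; rewrite ltnS geq_max => /andP[Nn Kn].
rewrite birkhoffS => Sn; exists n => //.
have : (B - a) < n%:R * (a - a').
  rewrite -ltr_pdivrMr ?subr_gt0//; apply: le_lt_trans (_ : `|B - a| / (a - a') < _).
    by rewrite ler_pM2r ?invr_gt0 ?subr_gt0// ler_norm.
  by apply: lt_le_trans (truncnS_gt _) _; rewrite ler_nat.
have := hB x; rewrite ler_norml => /andP[_].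
move: Sn; rewrite -natr1; lra.
Qed.

Lemma frequently_above_preimage g a a' x : bounded_measurable g -> a' < a ->
  frequently_above g a (f x) -> frequently_above g a' x.
Proof.
move=> [_ [B hB]] a'a ax N.
have [n] := ax (maxn N (Num.trunc (`|B + a'| / (a - a'))).+1).
rewrite geq_max => /andP[Nn Kn] Sn; exists n.+1; first exact: leqW.
have : (B + a') < n%:R * (a - a').
  rewrite -ltr_pdivrMr ?subr_gt0//; apply: le_lt_trans (_ : `|B + a'| / (a - a') < _).
    by rewrite ler_pM2r ?invr_gt0 ?subr_gt0// ler_norm.
  by apply: lt_le_trans (truncnS_gt _) _; rewrite ler_nat.
rewrite birkhoffS -natr1; have := hB x; rewrite ler_norml => /andP[+ _].
move: Sn; lra.
Qed.

Lemma measurable_birkhoff_gt g a n : bounded_measurable g ->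
  measurable ([set x | a < birkhoff f g n x] : set (borel X)).
Proof.
by move=> bg; apply: measurable_gt_cst; have [] := bounded_birkhoff n bg.
Qed.

Lemma frequently_aboveE g a : frequently_above g a =
  \bigcap_N \bigcup_(n in [set n | (N <= n)%N]) [set x | n%:R * a < birkhoff f g n x].
Proof.
apply/seteqP; split => x /= ax.
  by move=> N _; have [n Nn Sn] := ax N; exists n.
by move=> N; have [n Nn Sn] := ax N I; exists n.
Qed.

Lemma measurable_tail_above g a N : bounded_measurable g ->
  measurable (\bigcup_(n in [set n | (N <= n)%N])
    [set x | n%:R * a < birkhoff f g n x] : set (borel X)).
Proof.
by move=> bg; apply: bigcup_measurable => n _; exact: measurable_birkhoff_gt.
Qed.

(** Intersecting over levels [v k] increasing to [c] absorbs the gaps and makes [E] strictly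
    invariant. If [E] had full measure, then for some [v k] above the mean the sums of [g - v k]
    would become positive almost everywhere, and the maximal inequality would put the mean at or
    above [v k]. So [E] is null, and the tail events at level [c] decrease to a subset of it. *)
Lemma ergodic_birkhoff_le g c e : ergodic_measure f mu -> bounded_measurable g ->
  mean mu g < c -> 0 < e ->
  exists N, forall n, (N <= n)%N -> prob [set x | n%:R * c < birkhoff f g n x] <= e.
Proof.
move=> [_ erg] bg gc e0.
pose v k : R := c - k.+1%:R^-1.
have vS k : v k < v k.+1.
  by rewrite /v ltrD2l ltrN2 ltf_pV2 ?posrE ?ltr0n// ltr_nat.
have vc k : v k < c by rewrite /v ltrBlDr ltrDl invr_gt0.
pose E := \bigcap_k frequently_above g (v k).
have mE : measurable E.
  apply: bigcapT_measurable => k; rewrite frequently_aboveE.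
  by apply: bigcapT_measurable => N; exact: measurable_tail_above.
have fE : f @^-1` E = E.
  apply/seteqP; split => x Ex k _.
    exact: (frequently_above_preimage bg (vS k) (Ex k.+1 I)).
  exact: (frequently_above_f bg (vS k) (Ex k.+1 I)).
have E0 : prob E = 0.
  have [E0|E1] := erg E mE fE; first by rewrite /prob E0.
  have [k gk] : exists k, mean mu g < v k.
    exists (Num.trunc ((c - mean mu g)^-1)); rewrite /v ltrBrDr -ltrBrDl.
    rewrite invf_plt ?posrE ?subr_gt0//; exact: truncnS_gt.
  have bv : bounded_measurable (fun=> - v k) by exact: bounded_measurable_cst.
  have := @maximal_ergodic (g \+ fun=> - v k) (bounded_measurableD bg bv).
  rewrite meanD// mean_cst => H; suff : 0 <= mean mu g - v k by lra.
  pose Z : set (borel X) :=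
    [set x | forall n, birkhoff f (g \+ fun=> - v k) n x <= 0].
  apply: H; rewrite -[LHS]/(prob Z).
  have mZ : measurable Z.
    rewrite (_ : Z = \bigcap_n [set x | birkhoff f (g \+ fun=> - v k) n x <= 0]).
      apply: bigcapT_measurable => n.
      have [mS _] := bounded_birkhoff n (bounded_measurableD bg bv).
      exact: measurable_le_cst.
    by apply/seteqP; split => [x H' n _|x H' n]; [exact: H'|exact: (H' n I)].
  have : prob (Z `|` E) = prob Z + prob E.
    case: prob_fa_prob => _ _; apply => //.
    rewrite -subset0 => x [/= Zx /(_ k I 0)[n _]]; rewrite ltNge => /negP; apply.
    have := Zx n; rewrite /birkhoff big_split/= sumr_const card_ord.
    by rewrite mulNrn subr_le0 -[v k *+ n]mulr_natl.
  have : prob (Z `|` E) <= 1.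
    case: (prob_fa_prob) => _ <- _.
    by apply: (fa_prob_le prob_fa_prob) => //; exact: measurableU.
  have : 0 <= prob Z by rewrite fine_ge0.
  have -> : prob E = 1 by rewrite /prob E1.
  by move=> ? ? ?; lra.
have [|||N HN] := @prob_nonincreasing (fun N => \bigcup_(n in [set n | (N <= n)%N])
    [set x | n%:R * c < birkhoff f g n x]) e _ _ _ e0.
- by move=> n; exact: measurable_tail_above.
- by move=> n x [m /= nm Sm]; exists m => //=; exact: ltnW.
- apply/eqP; rewrite eq_le; apply/andP; split; last by rewrite fine_ge0.
  rewrite -E0; apply: (fa_prob_le prob_fa_prob) => //.
    by apply: bigcapT_measurable => N; exact: measurable_tail_above.
  rewrite -frequently_aboveE => x cx k _ N; have [n Nn Sn] := cx N.
  by exists n => //; rewrite (le_lt_trans _ Sn)// ler_wpM2l// ltW.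
exists N => n Nn; apply: le_trans (HN n Nn).
apply: (fa_prob_le prob_fa_prob).
- exact: measurable_birkhoff_gt.
- exact: measurable_tail_above.
- by move=> x Sx; exists n => /=.
Qed.

Lemma weak_ergodic_law g e e' : ergodic_measure f mu -> bounded_measurable g ->
  0 < e -> 0 < e' ->
  exists N, forall n, (N <= n)%N ->
    prob [set x | n%:R * e < `|birkhoff f g n x - n%:R * mean mu g|] <= e'.
Proof.
move=> erg bg e0 e'0.
have bNg : bounded_measurable (fun x => -1 * g x) by exact: bounded_measurableZ.
have e'2 : 0 < e' / 2 by rewrite divr_gt0.
have [|N1 H1] := @ergodic_birkhoff_le g (mean mu g + e) (e' / 2) erg bg _ e'2.
  by rewrite ltrDl.
have [|N2 H2] := @ergodic_birkhoff_le _ (- mean mu g + e) (e' / 2) erg bNg _ e'2.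
  by rewrite meanZ// mulN1r ltrDl.
exists (maxn N1 N2) => n; rewrite geq_max => /andP[/H1 le1 /H2 le2].
rewrite [e']splitr; apply: le_trans (lerD le1 le2).
set A := [set x | _ < birkhoff f g n x]; set B := [set x | _ < birkhoff f _ n x].
have mA : measurable (A : set (borel X)) by exact: measurable_birkhoff_gt.
have mB : measurable (B : set (borel X)) by exact: measurable_birkhoff_gt.
have AB : prob (A `|` B) <= prob A + prob B.
  have -> : A `|` B = A `|` (B `\` A) by rewrite setUDr setDv setD0.
  have mBA : measurable (B `\` A : set (borel X)) by exact: measurableD.
  case: (prob_fa_prob) => _ _ ->; rewrite ?setDIK// lerD2l.
  by apply: (fa_prob_le prob_fa_prob) => // x [].
apply: le_trans AB; apply: (fa_prob_le prob_fa_prob).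
- have [mS [M hM]] := bounded_birkhoff n bg.
  apply: measurable_gt_cst; apply: measurableT_comp => //.
  exact: measurable_funB.
- exact: measurableU.
- move=> x /=; rewrite /A /B /= => H.
  have -> : birkhoff f (fun x => -1 * g x) n x = - birkhoff f g n x.
    by rewrite /birkhoff -mulr_sumr mulN1r.
  move: H; rewrite ltr_normr => /orP[H|H]; [left|right]; lra.
Qed.

End Invariant.
End BoundedMean.

(** * Regularity of Borel probabilities on a metric space *)

Section Regularity.
Context {R : realType} {X : pmetricType R} (mu : probability (borel X) R).

Lemma borel_open (U : set X) : open U -> measurable (U : set (borel X)).
Proof. by move=> oU; apply: sub_sigma_algebra. Qed.

Lemma borel_closed (K : set X) : closed K -> measurable (K : set (borel X)).
Proof.
move=> cK; rewrite -[K]setCK; apply: measurableC; apply: borel_open.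
exact: closed_openC.
Qed.

Lemma open_mdist (x : X) (r : R) : open [set y | mdist x y < r].
Proof.
rewrite openE => y /= xy.
rewrite /interior -nbhs_ballE; exists (r - mdist x y) => /=; first by rewrite subr_gt0.
move=> z; rewrite ballEmdist /= ltrBrDl => yz.
exact: le_lt_trans (metric_triangle _ y _) yz.
Qed.

Lemma probU_le (A B : set (borel X)) : measurable A -> measurable B ->
  prob mu (A `|` B) <= prob mu A + prob mu B.
Proof.
move=> mA mB; have -> : A `|` B = A `|` (B `\` A) by rewrite setUDr setDv setD0.
have mBA : measurable (B `\` A) by exact: measurableD.
case: (prob_fa_prob mu) => _ _ ->; rewrite ?setDIK// lerD2l.
by apply: (fa_prob_le (prob_fa_prob mu)) => // x [].
Qed.

(** Approximation is two-sided so that complements of regular sets are regular and these sets form a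
    sigma-algebra. *)
Definition regular_set (A : set (borel X)) := forall e : R, 0 < e ->
  exists K U : set X, [/\ closed K, open U, K `<=` A, A `<=` U &
    prob mu (U `\` K) <= e].

Lemma regular_open (U : set X) : open U -> regular_set U.
Proof.
move=> oU e e0.
pose F n : set X := [set x | forall y, ~ U y -> n.+1%:R^-1 <= mdist x y].
have cF n : closed (F n).
  rewrite -openC (_ : ~` F n =
    \bigcup_(y in ~` U) [set x | mdist y x < n.+1%:R^-1]).
    by apply: bigcup_open => y _; exact: open_mdist.
  apply/seteqP; split => x.
    move=> /existsNP[y /not_implyP[nUy /negP]]; rewrite -ltNge metric_sym => xy.
    by exists y.
  by move=> [y nUy /= xy] /(_ y nUy); rewrite metric_sym leNgt xy.
have mD n : measurable (U `\` F n : set (borel X)).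
  by apply: measurableD; [exact: borel_open|exact: borel_closed].
have [||N HN] := @prob_nonincreasing _ _ mu (fun n => U `\` F n) e mD _ _ e0.
- move=> n x [Ux nF]; split => // Fn; apply: nF => y nUy.
  by rewrite (le_trans _ (Fn y nUy))// lef_pV2 ?posrE ?ltr0n// ler_nat.
- rewrite (_ : \bigcap_n _ = set0) ?(fa_prob0 (prob_fa_prob mu))//.
  rewrite -subset0 => x Hx; have [Ux _] := Hx 0 I.
  have : nbhs x U by exact: open_nbhs_nbhs.
  rewrite -nbhs_ballE => -[r /= r0 rU].
  have [_] := Hx (Num.trunc r^-1) I; apply => y nUy.
  apply: contrapT => /negP; rewrite -ltNge => xy; apply: nUy; apply: rU.
  rewrite ballEmdist /= (lt_trans xy)// invf_plt ?posrE//; exact: truncnS_gt.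
- exists (F N), U; split => //; last exact: HN.
  move=> x Fx; apply: contrapT => nUx; have := Fx x nUx.
  by rewrite mdistxx leNgt invr_gt0 ltr0n.
Qed.

Lemma regularC A : regular_set A -> regular_set (~` A).
Proof.
move=> rA e /rA[K [U [cK oU KA AU KUe]]]; exists (~` U), (~` K); split.
- exact: open_closedC.
- exact: closed_openC.
- exact: subsetC.
- exact: subsetC.
- by rewrite setDE setCK setIC -setDE.
Qed.

Lemma regular_bigcup (A : (set (borel X))^nat) :
  (forall n, regular_set (A n)) -> regular_set (\bigcup_n A n).
Proof.
move=> rA e e0; have e2 : 0 < e / 2 by rewrite divr_gt0.
have e2n n : 0 < e / 2 / (2 ^ n.+1)%:R by rewrite divr_gt0// ltr0n expn_gt0.
have /choice[K /choice[U KU]] := fun n => rA n _ (e2n n).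
have oU : open (\bigcup_n U n) by apply: bigcup_open => n _; have [] := KU n.
have cK n : closed (K n) by have [] := KU n.
have mK n : measurable (K n : set (borel X)) by exact: borel_closed.
have mU n : measurable (U n : set (borel X)) by apply: borel_open; have [] := KU n.
pose KN N : set (borel X) := \bigcup_(i < N) K i.
have cKN N : closed (KN N) by rewrite /KN; apply: closed_bigcup.
have mKN N : measurable (KN N) by exact: borel_closed.
have mKo : measurable (\bigcup_n K n : set (borel X)) by exact: bigcup_measurable.
have mUo : measurable (\bigcup_n U n : set (borel X)) by exact: borel_open.
have UK : prob mu (\bigcup_n U n `\` \bigcup_n K n) <= e / 2.
  rewrite -lee_fin -probE; last exact: measurableD.
  apply: (@le_trans _ _ (\sum_(n <oo) mu (U n `\` K n))%E).
    apply: measure_sigma_subadditive => //.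
    - by move=> n; exact: measurableD.
    - exact: measurableD.
    - move=> x [[n _ Un] nK]; exists n => //; split=> // Kn; apply: nK.
      by exists n.
  have := @epsilon_trick R (fun=> 0%E) (e/2) xpredT (fun=> lexx _) (ltW e2).
  rewrite [X in (_ <= X + _)%E]eseries0// add0e; apply: le_trans; apply: lee_nneseries => n _ //.
  rewrite add0e probE ?lee_fin; first by have [] := KU n.
  exact: measurableD.
(* A countable union of closed sets need not be closed, so the inner set is a finite union;
   continuity from above bounds what it omits. *)
have [|||N HN] := @prob_nonincreasing _ _ mu (fun N => \bigcup_n K n `\` KN N) _ _ _ _ e2.
- by move=> N; exact: measurableD.
- move=> N x [Kx nKN]; split => // -[i /= iN Ki]; apply: nKN.
  by exists i => //=; exact: leqW.
- rewrite (_ : \bigcap_n _ = set0) ?(fa_prob0 (prob_fa_prob mu))//.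
  rewrite -subset0 => x Hx; have [[n _ Kn] _] := Hx 0 I.
  by have [_] := Hx n.+1 I; apply; exists n => /=.
- exists (KN N), (\bigcup_n U n); split => //.
  + by move=> x [i _ Ki]; exists i => //; have [_ _ + _ _] := KU i; exact.
  + by apply: subset_bigcup => i _; have [] := KU i.
  + rewrite (splitr e); apply: le_trans (lerD UK (HN N (leqnn _))).
    apply: le_trans (probU_le _ _); try exact: measurableD.
    apply: (fa_prob_le (prob_fa_prob mu)); try exact: measurableD.
      by apply: measurableU; exact: measurableD.
    move=> x [Ux nKN]; have [Kx|nKx] := pselect ((\bigcup_n K n) x).
      by right.
    by left.
Qed.

Lemma borel_regular (A : set (borel X)) : measurable A -> regular_set A.
Proof.
apply: smallest_sub; last exact: regular_open.
split.
- exact: (regular_open open0).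
- by move=> B; rewrite setTD; exact: regularC.
- exact: regular_bigcup.
Qed.

Lemma inner_regular (A : set (borel X)) (e : R) : measurable A -> 0 < e ->
  exists K : set X, [/\ closed K, K `<=` A & prob mu (A `\` K) <= e].
Proof.
move=> mA e0; have [K [U [cK oU KA AU KUe]]] := borel_regular mA e0.
exists K; split => //; apply: le_trans KUe.
have mK := borel_closed cK; have mU := borel_open oU.
apply: (fa_prob_le (prob_fa_prob mu)); try exact: measurableD.
exact: setSD.
Qed.

End Regularity.

(** Chernoff's bound: give each name the weight [expR (- a * distance)]. Members of the ball weigh
    at least [expR (- a * D)], and the total weight factorizes over the positions, with factors at
    most [1 + k * expR (- a)]. *)
Lemma card_hamming_ball {R : realType} (k n : nat) (a D : R)
    (s : {ffun 'I_n -> 'I_k}) : 0 < a ->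
  (#|[set s' : {ffun 'I_n -> 'I_k} | \sum_i (s i != s' i)%:R <= D]%SET|)%:R <=
  expR (a * D) * (1 + k%:R * expR (- a)) ^+ n :> R.
Proof.
move=> a0; set B := [set s' | _]%SET.
rewrite -ler_pdivrMl ?expR_gt0// -expRN.
apply: (@le_trans _ _ (\sum_(s' in B) expR (- (a * \sum_i (s i != s' i)%:R)))).
  rewrite -sum1_card natr_sum mulr_sumr; apply: ler_sum => s'; rewrite inE => s'D.
  by rewrite mulr1 ler_expR lerN2 ler_pM2l.
apply: (@le_trans _ _ (\sum_(s' : {ffun 'I_n -> 'I_k})
    \prod_i expR (- (a * (s i != s' i)%:R)))).
  rewrite [leRHS](bigID (mem B))/= ler_wpDr//.
    by apply: sumr_ge0 => s' _; apply: prodr_ge0 => i _; exact: expR_ge0.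
  apply: ler_sum => s' _; rewrite mulr_sumr -sumrN expR_sum//.
rewrite -(bigA_distr_bigA (fun i j => expR (- (a * (s i != j)%:R)))).
rewrite -[X in _ ^+ X](card_ord n) -prodr_const; apply: ler_prod => i _.
rewrite sumr_ge0; last by move=> j _; exact: expR_ge0.
rewrite (bigD1 (s i))//= eqxx mulr0 oppr0 expR0 lerD2l.
apply: (@le_trans _ _ (\sum_(j < k | j != s i) expR (- a))).
  by apply: ler_sum => j ji; rewrite eq_sym ji mulr1.
rewrite -[X in X%:R * _](card_ord k) mulr_natl -sumr_const.
by rewrite [leRHS](bigD1 (s i))//= lerDr expR_ge0.
Qed.

Lemma continuous_bounded_measurable {R : realType} {X : pmetricType R}
    (g : X -> R) : compact [set: X] -> continuous g ->
  bounded_measurable (g : borel X -> R).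
Proof.
move=> kX cg; split.
  apply: (measurability _ (RGenOpens.measurableE R)).
  move=> _ [_ [a [b ->] <-]]; rewrite setTI; apply: borel_open.
  by move/continuousP : cg => /(_ _ (interval_open _ _)); exact.
have : compact (g @` setT) by apply: continuous_compact => //; exact: continuous_subspaceT.
move=> /compact_bounded [M [_ HM]]; exists (M + 1) => x.
by apply: (HM (M + 1)); [rewrite ltrDl|exists x].
Qed.

Lemma closed_disjoint_dist {R : realType} {X : pmetricType R} (A B : set X) :
  compact [set: X] -> closed A -> closed B -> A `&` B = set0 ->
  \forall e \near 0^'+, forall x y, A x -> B y -> e <= mdist x y.
Proof.
move=> kX cA cB AB.
have kA : compact A by apply: subclosed_compact kX _.
have := kA; rewrite compact_near_coveringP.
move=> /(_ R (0^'+) (fun e x => forall y, B y -> e <= mdist x y) _) H.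
have {}H : \forall e \near 0^'+, A `<=` (fun x => forall y, B y -> e <= mdist x y).
  apply: H => x Ax.
  have : nbhs x (~` B).
    apply: open_nbhs_nbhs; split; first exact: closed_openC.
    by move=> Bx; have : (A `&` B) x by []; rewrite AB.
  rewrite -nbhs_ballE => -[r /= r0 rB].
  exists (ball x (r / 2), [set e | e <= r / 2]) => /=.
    split; first by apply: nbhsx_ballx; rewrite divr_gt0.
    by apply: nbhs_right_le; rewrite divr_gt0.
  move=> [x' e] [/= xx' er] y By; apply: (le_trans er).
  have : r <= mdist x y.
    rewrite leNgt; apply/negP => xy; apply: (rB y) => //.
    by rewrite ballEmdist.
  move: xx'; rewrite ballEmdist /= => xx'.
  have := metric_triangle x x' y; lra.
near=> e => x y Ax By; suff : A `<=` (fun x => forall y, B y -> e <= mdist x y) by exact.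
by near: e.
Unshelve. all: by end_near. Qed.

(** * Entropy of a partition as a limit over block lengths *)

Section SubadditiveLimit.
Context {R : realType} (u : nat -> R) (C : R).
Hypothesis u_ge0 : forall n, 0 <= u n.
Hypothesis u_sub : forall q n, q%:R * u n <= n%:R * u q + q%:R ^+ 2 * C.

Let rate n := n%:R^-1 * u n.

(** Fekete's argument, started from the block inequality: division by [q * n] gives
    [rate n <= rate q + q * C / n], so the limit is the infimum of the rates. *)
Lemma subadditive_cvg : exists L, rate n @[n --> \oo] --> L /\
  forall q, (0 < q)%N -> L <= rate q.
Proof.
pose S := [set rate q | q in [set q | (0 < q)%N]].
have S0 : lbound S 0 by move=> _ [q _ <-]; rewrite /rate mulr_ge0 ?invr_ge0.
have infS : has_inf S by split; [exists (rate 1%N), 1%N|exists 0].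
have SL q : (0 < q)%N -> inf S <= rate q.
  by move=> q0; apply: ge_inf; [exists 0|exists q].
exists (inf S); split => //.
apply/cvgrPdist_le => e e0; have e2 : 0 < e / 2 by rewrite divr_gt0.
have [_ [q /= q0 <-] qe] := inf_adherent e2 infS.
have qR : 0 < q%:R :> R by rewrite ltr0n.
near=> n.
have n0 : (0 < n)%N by near: n; exists 1%N.
have nR : 0 < n%:R :> R by rewrite ltr0n.
rewrite distrC ger0_norm ?subr_ge0 ?SL// lerBlDl.
have : rate n <= rate q + q%:R * C / n%:R.
  have := u_sub q n; rewrite /rate => H.
  rewrite -(ler_pM2l nR) -(ler_pM2l qR).
  have -> : q%:R * (n%:R * (n%:R^-1 * u n)) = q%:R * u n.
    by rewrite [X in _ * X]mulrA divff ?mul1r// lt0r_neq0.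
  apply: (le_trans H); rewrite le_eqVlt; apply/orP; left; apply/eqP.
  by field; rewrite !lt0r_neq0.
have : q%:R * C / n%:R <= e / 2.
  rewrite ler_pdivrMr// -ler_pdivrMl//.
  near: n; exact: nbhs_infty_ger.
move: qe; lra.
Unshelve. all: by end_near. Qed.

End SubadditiveLimit.

Section PartitionEntropy.
Context {R : realType} {X : pmetricType R} (f : X -> X).
Variable mu : probability (borel X) R.
Hypothesis mf : forall A : set (borel X),
  measurable A -> measurable (f @^-1` A : set (borel X)).
Hypothesis imu : invariant_measure f mu.
Context {k : nat} {xi : borel X -> 'I_k}.
Hypothesis mxi : measurable_partition xi.

Lemma prob_iter n (A : set (borel X)) : measurable A ->
  prob mu (iter n f @^-1` A) = prob mu A.
Proof.
move=> mA; elim: n => [//|n IH].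
rewrite (_ : iter n.+1 f @^-1` A = f @^-1` (iter n f @^-1` A)).
  by rewrite -IH /prob imu//; exact: (@measurable_iter _ (borel X)).
by apply/seteqP; split => x /=; rewrite -iterSr.
Qed.

Lemma join_entropyE n :
  join_entropy f mu xi n = block_entropy (X := borel X) f xi (prob mu) 0 n.
Proof.
rewrite /join_entropy /block_entropy /entropy; congr (- _).
apply: eq_bigr => s _.
suff -> : cell f xi s = itinerary (X := borel X) f xi 0 n @^-1` [set s] by [].
apply/seteqP; split => x /=.
  by move=> xs; apply/ffunP => i; rewrite ffunE add0n xs.
by move=> <- i; rewrite ffunE add0n.
Qed.

Lemma block_entropy_invariant p q :
  block_entropy (X := borel X) f xi (prob mu) p q =
  block_entropy (X := borel X) f xi (prob mu) 0 q.
Proof.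
rewrite block_entropy_shift /block_entropy; congr entropy; apply/funext => s.
by rewrite /law prob_iter//; exact: (@measurable_itinerary _ (borel X)).
Qed.

(** By invariance the blocks at all starting times have equal entropy, and the telescoping estimate
    becomes the hypothesis of [subadditive_cvg] with [C = 2 * ln k]. The second half carries a bound
    valid at every fixed block length over to the entropy. *)
Lemma partition_entropy_cvg :
  n%:R^-1 * join_entropy f mu xi n @[n --> \oo] --> partition_entropy f mu xi /\
  forall c, (forall q, (0 < q)%N -> c <= q%:R^-1 * join_entropy f mu xi q) ->
    c <= partition_entropy f mu xi.
Proof.
have k0 : (0 < k)%N by case: k xi => [|//] xi'; case: (xi' point).
have [||L [L1 L2]] := @subadditive_cvg R
    (block_entropy (X := borel X) f xi (prob mu) 0) (2 * ln k%:R).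
- by move=> n; apply: block_entropy_ge0 => //; exact: prob_fa_prob.
- move=> q n; apply: le_trans (block_entropy_telescope _ _ _ _ _ k0) _ => //.
    exact: prob_fa_prob.
  under eq_bigr do rewrite block_entropy_invariant.
  rewrite sumr_const card_ord -[_ *+ n]mulr_natl lerD2l.
  by rewrite le_eqVlt; apply/orP; left; apply/eqP; ring.
have LE : (fun n => n%:R^-1 * join_entropy f mu xi n) @ \oo --> L.
  by under eq_fun do rewrite join_entropyE.
have <- : L = partition_entropy f mu xi by apply/esym/cvg_lim.
split => // c cq; have <- := cvg_lim (@Rhausdorff R) LE.
apply: limr_ge; first exact: cvgP LE.
near=> n; apply: cq.
by near: n; exists 1%N.
Unshelve. all: by end_near. Qed.

End PartitionEntropy.

Lemma edist_near {R : realType} (m : nat) (w v : 'rV[R]_m) (r : R) :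
  Defs.edist w v < r -> exists2 d, 0 < d &
  forall u : 'rV[R]_m, (forall i, `|u ord0 i - v ord0 i| <= d) -> Defs.edist w u < r.
Proof.
rewrite /Defs.edist => wvr; have r0 : 0 < r by apply: le_lt_trans wvr; exact: sqrtr_ge0.
have sqlt (t : R) : (Num.sqrt t < r) = (t < r ^+ 2).
  by rewrite -[in LHS](ger0_norm (ltW r0)) -sqrtr_sqr ltr_sqrt// exprn_gt0.
move: wvr; rewrite sqlt; set D := \sum_i _ => Dr.
pose M := \sum_i (2 * `|w ord0 i - v ord0 i| + 1) : R.
have M0 : 0 <= M by apply: sumr_ge0 => i _; rewrite addr_ge0// mulr_ge0.
(* As [d <= 1], a change of at most [d] in a coordinate difference [p] raises its square by at most
   [d * (2 * |p| + 1)]; [M] sums these rates. *)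
pose d := Num.min 1 ((r ^+ 2 - D) / (M + 1)).
have d0 : 0 < d by rewrite lt_min ltr01 divr_gt0 ?subr_gt0// ltr_wpDl.
exists d => // u ud; rewrite sqlt.
apply: (@le_lt_trans _ _ (D + d * M)).
  rewrite /D /M mulr_sumr -big_split/=; apply: ler_sum => i _.
  have -> : w ord0 i - u ord0 i = (w ord0 i - v ord0 i) - (u ord0 i - v ord0 i) by ring.
  have := ud i; move: (w ord0 i - v ord0 i) (u ord0 i - v ord0 i) => p q qd.
  have d1 : d <= 1 by rewrite ge_min lexx.
  have pq : - (p * q) <= `|p| * d.
    by rewrite (le_trans (ler_norm _))// normrN normrM ler_wpM2l.
  have qq : q ^+ 2 <= d.
    rewrite -real_normK ?num_real//; apply: (@le_trans _ _ (d ^+ 2)).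
      by rewrite lerXn2r// nnegrE ltW.
    by rewrite expr2 ger_pMr.
  have -> : (p - q) ^+ 2 = p ^+ 2 + 2 * - (p * q) + q ^+ 2 by ring.
  have -> : p ^+ 2 + d * (2 * `|p| + 1) = p ^+ 2 + 2 * (`|p| * d) + d by ring.
  by rewrite !lerD// ler_pM2l.
have : d * (M + 1) <= r ^+ 2 - D.
  by rewrite -ler_pdivlMr ?ltr_wpDl// ge_min lexx orbT.
move: d0; lra.
Qed.

Section FiniteUnion.
Context {R : realType} {X : pmetricType R} (mu : probability (borel X) R).

Lemma prob_bigcup_le (I : finType) (F : I -> set (borel X)) :
  (forall i, measurable (F i)) ->
  prob mu (\bigcup_i F i) <= \sum_i prob mu (F i).
Proof.
move=> mF; suff H (s : seq I) : measurable (\bigcup_(i in [set` s]) F i) /\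
    prob mu (\bigcup_(i in [set` s]) F i) <= \sum_(i <- s) prob mu (F i).
  have [_] := H (index_enum I); rewrite (_ : [set` index_enum I] = setT)//.
  by apply/seteqP; split => i //= _; rewrite mem_index_enum.
elim: s => [|i s [mS IH]].
  by rewrite set_nil bigcup_set0 big_nil (fa_prob0 (prob_fa_prob mu)).
have -> : \bigcup_(j in [set` i :: s]) F j = F i `|` \bigcup_(j in [set` s]) F j.
  apply/seteqP; split => x.
    by move=> [j /=]; rewrite inE => /orP[/eqP ->|js] Fx; [left|right; exists j].
  move=> [Fx|[j /= js Fx]]; [exists i|exists j] => //=; rewrite inE ?eqxx//.
  by rewrite js orbT.
rewrite big_cons; split; first exact: measurableU.
by rewrite (le_trans (probU_le _ _ _))// lerD2l.
Qed.

Lemma weak_ergodic_family (f : X -> X) (I : finType) (g : I -> borel X -> R)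
    (e : I -> R) (d : R) :
  (forall A : set (borel X), measurable A -> measurable (f @^-1` A : set (borel X))) ->
  ergodic_measure f mu -> (forall i, bounded_measurable (g i)) ->
  (forall i, 0 < e i) -> 0 < d ->
  exists N, forall n, (N <= n)%N ->
    measurable ([set x | exists i, n%:R * e i <
      `|birkhoff f (g i) n x - n%:R * mean mu (g i)|] : set (borel X)) /\
    prob mu [set x | exists i, n%:R * e i <
      `|birkhoff f (g i) n x - n%:R * mean mu (g i)|] <= d.
Proof.
move=> mf erg bg e0 d0; have imu : invariant_measure f mu by case: erg.
have d'0 : 0 < d / (#|I|.+1)%:R by rewrite divr_gt0// ltr0n.
have /choice[N HN] := fun i => weak_ergodic_law mf imu erg (bg i) (e0 i) d'0.
pose F n i : set (borel X) := [set x | n%:R * e i <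
  `|birkhoff f (g i) n x - n%:R * mean mu (g i)|].
have mF n i : measurable (F n i).
  have [mS _] := bounded_birkhoff mf n (bg i).
  apply: measurable_gt_cst; apply: measurableT_comp => //.
  exact: measurable_funB.
have FE n : [set x | exists i, n%:R * e i <
    `|birkhoff f (g i) n x - n%:R * mean mu (g i)|] = \bigcup_i F n i.
  by apply/seteqP; split => x [i ? ]; exists i.
exists (\max_i N i) => n Nn; rewrite FE; split.
  by apply: fin_bigcup_measurable => // i _; exact: mF.
apply: (le_trans (prob_bigcup_le (mF n))).
apply: (@le_trans _ _ (\sum_(i : I) d / (#|I|.+1)%:R)).
  apply: ler_sum => i _; apply: HN; apply: leq_trans Nn; exact: leq_bigmax.
rewrite sumr_const -[_ *+ _]mulr_natr -mulrA ger_pMr// mulrC ler_pdivrMr ?ltr0n//.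
by rewrite mul1r ler_nat.
Qed.

End FiniteUnion.

Lemma bowen_distC {R : realType} {X : pmetricType R} (f : X -> X) n x y :
  bowen_dist f n x y = bowen_dist f n y x.
Proof. by apply: eq_bigr => i _; rewrite metric_sym. Qed.

Lemma bowen_dist_ge {R : realType} {X : pmetricType R} (f : X -> X) n x y i :
  (i < n)%N -> mdist (iter i f x) (iter i f y) <= bowen_dist f n x y.
Proof.
move=> i_n; exact: (le_bigmax _ (fun i : 'I_n => mdist (iter i f x) (iter i f y)) (Ordinal i_n)).
Qed.

(* A maximal separated family of representatives of the cells; every other
   cell has a name in the Hamming ball around the name of one of them. *)
Lemma separated_representatives {R : realType} {X : pmetricType R} (f : X -> X)
    (n k : nat) (L : X -> {ffun 'I_n -> 'I_k}) (G : set X) (e a D : R) :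
  0 < a -> 0 < e ->
  (forall x y, G x -> G y -> bowen_dist f n x y < e ->
    \sum_i (L x i != L y i)%:R <= D) ->
  exists S : {set {ffun 'I_n -> 'I_k}}, exists rep : {ffun 'I_n -> 'I_k} -> X,
  [/\ forall s, s \in S -> G (rep s) /\ L (rep s) = s,
      forall s s', s \in S -> s' \in S -> s != s' -> e <= bowen_dist f n (rep s) (rep s') &
      (#|[set s | `[< exists2 x, G x & L x = s >]]%SET|)%:R <=
      (#|S|)%:R * (expR (a * D) * (1 + k%:R * expR (- a)) ^+ n)].
Proof.
move=> a0 e0 GD; set T := [set s | _]%SET.
pose rep s : X := xget point [set x | G x /\ L x = s].
have repP s : s \in T -> G (rep s) /\ L (rep s) = s.
  rewrite inE => /asboolP[x Gx Lx]; rewrite /rep.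
  by case: xgetP => [y -> //|/(_ x)]; case.
pose sep (S : {set {ffun 'I_n -> 'I_k}}) := (S \subset T) &&
  [forall s in S, forall s' in S, (s != s') ==> (e <= bowen_dist f n (rep s) (rep s'))].
have sep0 : sep finset.set0.
  by rewrite /sep finset.sub0set; apply/forall_inP => s; rewrite inE.
have [S /maxsetP[/andP[ST /forall_inP Ssep] Smax] _] := maxset_exists sep0.
have Ssep' s s' : s \in S -> s' \in S -> s != s' ->
    e <= bowen_dist f n (rep s) (rep s').
  by move=> sS s'S; have /forall_inP/(_ s' s'S)/implyP := Ssep s sS.
exists S, rep; split => // [s sS|]; first by apply: repP; exact: (fintype.subsetP ST).
pose B s := [set s' : {ffun 'I_n -> 'I_k} | \sum_i (s i != s' i)%:R <= D]%SET.
(* A name covered by no ball would be separated from all representatives, hence belong to [S] by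
   maximality, hence lie in its own ball. *)
have cover s : s \in T -> exists2 s', s' \in S & s \in B s'.
  move=> sT; apply: contrapT => nex.
  have close s' : s' \in S -> e <= bowen_dist f n (rep s') (rep s).
    move=> s'S; rewrite leNgt; apply/negP => ss'; apply: nex; exists s' => //.
    have [Gs Ls] := repP s sT; have [Gs' Ls'] := repP s' (fintype.subsetP ST s' s'S).
    by rewrite inE -{1}Ls' -{1}Ls; exact: GD.
  have sS : s \in S.
    suff : (s |: S)%SET = S by move=> <-; rewrite finset.setU11.
    apply: Smax; last exact: finset.subsetUr.
    apply/andP; split; first by rewrite finset.subUset finset.sub1set sT.
    apply/forall_inP => s1; rewrite !inE => s1S; apply/forall_inP => s2.
    rewrite !inE => s2S; apply/implyP.
    move: s1S s2S => /orP[/eqP->|s1S] /orP[/eqP->|s2S]; rewrite ?eqxx// => ne.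
    - by rewrite bowen_distC; exact: close.
    - exact: close.
    - exact: Ssep'.
  apply: nex; exists s => //; have [Gs Ls] := repP s sT.
  rewrite inE -{1 2}Ls; apply: GD => //.
  rewrite /bowen_dist; apply: bigmax_lt => // i _; by rewrite mdistxx.
apply: (@le_trans _ _ (\sum_(s' in S) (#|B s'|)%:R)).
  apply: (@le_trans _ _ (\sum_(s in T) \sum_(s' in S) (s \in B s')%:R)).
    rewrite -sum1_card natr_sum; apply: ler_sum => s sT.
    have [s' s'S sB] := cover s sT.
    by rewrite (bigD1 s')//= sB lerDl sumr_ge0.
  rewrite exchange_big/=; apply: ler_sum => s' _.
  rewrite -sum1_card natr_sum [leRHS]big_mkcond/= [leLHS]big_mkcond/=.
  by apply: ler_sum => s _; case: (s \in T); case: (s \in B s').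
rewrite mulr_natl -sumr_const; apply: ler_sum => s _; exact: card_hamming_ball.
Qed.

Lemma continuous_borel {R : realType} {X : pmetricType R} (f : X -> X) :
  continuous f -> forall A : set (borel X),
  measurable A -> measurable (f @^-1` A : set (borel X)).
Proof.
move=> cf A mA; have mf : measurable_fun setT (f : borel X -> borel X).
  apply: (@measurability _ _ (borel X) (borel X) setT f (@open X)) => // _ [U oU <-]; rewrite setTI.
  by apply: borel_open; move/continuousP : cf; exact.
by have := mf measurableT A mA; rewrite setTI.
Qed.

(** * Lower bound: counting the names of typical orbits *)

Section LowerBound.
Context {R : realType} {X : pmetricType R} (f : X -> X) (m : nat).
Context (phi : X -> R) (Phi : X -> 'rV[R]_m).
Hypotheses (X_compact : compact [set: X]) (f_continuous : continuous f).
Hypotheses (phi_continuous : continuous phi) (Phi_continuous : continuous Phi).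

Lemma continuous_coord i : continuous (fun x => Phi x ord0 i).
Proof.
move=> x; apply: (@continuous_comp _ _ _ Phi (fun M : 'rV[R]_m => M ord0 i)).
  exact: Phi_continuous.
exact: coord_continuous.
Qed.

Lemma birkhoff_coord n x i :
  (n%:R^-1 *: birkhoff f Phi n x) ord0 i =
  n%:R^-1 * birkhoff f (fun y => Phi y ord0 i) n x.
Proof. by rewrite mxE /birkhoff summxE. Qed.

Lemma Nphi_ge n e w r (I : choiceType) (s : seq I) (rep : I -> X) :
  uniq s -> set_inj [set` s] rep ->
  ball_separated f Phi n e w r (rep @` [set` s]) ->
  ((\sum_(i <- s) expR (birkhoff f phi n (rep i)))%:E <= Nphi f phi Phi n e w r)%E.
Proof.
move=> us repI sepS; apply: ereal_sup_ubound; exists (rep @` [set` s]) => //.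
rewrite esum_image// esum_fset;
  [by rewrite -fsbig_seq// sumEFin|exact: finite_seq|].
by move=> i _; rewrite lee_fin expR_ge0.
Qed.

Variables (mu : probability (borel X) R) (k : nat) (xi : borel X -> 'I_k).
Hypotheses (erg : ergodic_measure f mu) (mxi : measurable_partition xi).

Let mf := continuous_borel f_continuous.
Let imu : invariant_measure f mu. Proof. by case: erg. Qed.

(** Cells may touch each other, but disjoint closed subsets of a compact space have a positive gap;
    its price is the small set outside the cores. *)
Lemma compact_core (d : R) : 0 < d -> exists B : 'I_k -> set X,
  [/\ forall j, closed (B j), forall j x, B j x -> xi x = j &
      prob mu (\bigcap_j ~` B j) <= d].
Proof.
move=> d0; have d'0 : 0 < d / (k.+1)%:R by rewrite divr_gt0// ltr0n.
have /choice[B HB] := fun j => inner_regular mu (mxi j) d'0.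
have cB j : closed (B j) by have [] := HB j.
have mB j : measurable (B j : set (borel X)) by exact: borel_closed.
exists B; split => // [j x Bx|]; first by have [_ /(_ x Bx)] := HB j.
have mD j : measurable (xi @^-1` [set j] `\` B j) by exact: measurableD.
apply: (@le_trans _ _ (prob mu (\bigcup_j (xi @^-1` [set j] `\` B j)))).
  apply: (fa_prob_le (prob_fa_prob mu)).
  - by apply: fin_bigcap_measurable => // j _; exact: measurableC.
  - by apply: fin_bigcup_measurable.
  - by move=> x Hx; exists (xi x) => //; split=> //; exact: Hx.
apply: (le_trans (prob_bigcup_le mu mD)).
apply: (@le_trans _ _ (\sum_(j < k) d / (k.+1)%:R)).
  by apply: ler_sum => j _; have [] := HB j.
rewrite sumr_const card_ord -[_ *+ _]mulr_natr -mulrA ger_pMr//.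
by rewrite mulrC ler_pdivrMr ?ltr0n// mul1r ler_nat.
Qed.

Let k_gt0 : (0 < k)%N.
Proof. by case: k xi => [|//] xi'; case: (xi' point). Qed.

(* Off a set of small probability the orbit up to time [n] has the right
   averages and rarely leaves the compact cores of the cells, so two nearby
   orbits have names at small Hamming distance; counting the names that are
   needed to carry the entropy then gives Katok's bound without the
   Shannon-McMillan-Breiman theorem. *)
Lemma Nphi_lower_bound (w : 'rV[R]_m) (r eta : R) :
  Defs.edist w (rv Phi mu) < r -> 0 < eta ->
  \forall e \near 0^'+, \forall n \near \oo,
    ((expR (n%:R * (partition_entropy f mu xi + mean mu phi - eta)))%:E <=
     Nphi f phi Phi n e w r)%E.
Proof.
move=> wr eta0.
(* One share of [e1] each goes to the convergence of the entropy, to [ln 2], to the names of bad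
   points and to the deviation of [phi]; two go to the Hamming balls. *)
pose e1 := eta / 6; have e1_gt0 : 0 < e1 by rewrite divr_gt0.
have k0 : 0 < k%:R :> R by rewrite ltr0n.
(* [a] makes [k * expR (- a) <= e1], and [gm] makes [a * D = n * e1] for the Hamming radius
   [D = n * (4 * gm)]; a ball then has at most [expR (n * (2 * e1))] elements. *)
pose a := `|ln (k%:R / e1)| + 1; have a0 : 0 < a by rewrite ltr_wpDl.
have ka : k%:R * expR (- a) <= e1.
  rewrite expRN ler_pdivrMr ?expR_gt0// mulrC -ler_pdivrMr//.
  rewrite -[leLHS]lnK ?posrE ?divr_gt0// ler_expR (le_trans (ler_norm _))//.
  by rewrite lerDl.
pose gm := e1 / (4 * a); have gm0 : 0 < gm by rewrite divr_gt0// mulr_gt0.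
have [B [cB Bxi B0g]] := compact_core gm0.
pose B0 : set (borel X) := \bigcap_j ~` B j.
have mB0 : measurable B0.
  apply: fin_bigcap_measurable => // j _; apply: measurableC.
  exact: borel_closed.
have [dl dl0 Hdl] := edist_near wr.
(* The bound [2^-1] keeps the good set nonempty; the other one limits the contribution of the bad
   points, which have at most [k ^ n] names, to [n * e1]. *)
pose dd := Num.min 2^-1 (e1 / (ln k%:R + 1)).
have lnk : 0 <= ln k%:R :> R by rewrite ln_ge0// ler1n.
have dd0 : 0 < dd by rewrite lt_min invr_gt0 ltr0n/= divr_gt0// ltr_wpDl.
(* One finite family collects all deviations to control: the coordinates of [Phi], [phi] itself, and
   the frequency of visits outside the cores. *)
pose g (i : option (option 'I_m)) : borel X -> R :=
  match i with Some (Some i) => fun x => Phi x ord0 i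
             | Some None => phi | None => \1_B0 end.
pose ee (i : option (option 'I_m)) : R :=
  match i with Some (Some i) => dl | Some None => e1 | None => gm end.
have bg i : bounded_measurable (g i).
  case: i => [[i|]|] /=.
  - by apply: continuous_bounded_measurable => //; exact: continuous_coord.
  - exact: continuous_bounded_measurable.
  - exact: bounded_measurable_indic.
have ee0 i : 0 < ee i by case: i => [[i|]|].
have [N HN] := @weak_ergodic_family R X mu f _ g ee dd mf erg bg ee0 dd0.
have [hcvg _] := partition_entropy_cvg mf imu mxi.
set h := partition_entropy f mu xi in hcvg *.
have sepB : \forall e \near 0^'+, forall j j' : 'I_k, j != j' ->
    forall x y, B j x -> B j' y -> e <= mdist x y.
  apply: filter_forall => j; apply: filter_forall => j'.
  have [->|jj'] := eqVneq j j'; first by apply: nearW.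
  near=> e => _; near: e; apply: closed_disjoint_dist => //.
  rewrite -subset0 => x [/Bxi xj /Bxi xj']; move/eqP: jj'; apply.
  by rewrite -xj -xj'.
near=> e.
have e_gt0 : 0 < e by near: e; exact: nbhs_right_gt.
have sepB' : forall j j' : 'I_k, j != j' ->
    forall x y, B j x -> B j' y -> e <= mdist x y by near: e.
near=> n.
have n0 : (0 < n)%N by near: n; exists 1%N.
have nR : 0 < n%:R :> R by rewrite ltr0n.
have Nn : (N <= n)%N by near: n; exists N.
have hn : h - e1 <= n%:R^-1 * join_entropy f mu xi n.
  near: n; move/cvgrPdist_le : hcvg => /(_ e1 e1_gt0).
  apply: filterS => n; rewrite ler_norml => /andP[_].
  by rewrite lerBlDr lerBlDl addrC.
have ln2n : ln 2 <= n%:R * e1.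
  rewrite -ler_pdivrMr//; near: n; exact: nbhs_infty_ger.
have [mbad pbad] := HN n Nn.
set bad := (X in prob mu X <= _) in mbad pbad.
pose L : X -> {ffun 'I_n -> 'I_k} := itinerary (X := borel X) f xi 0 n.
pose G : set X := ~` bad.
pose D := n%:R * (4 * gm).
have GD x y : G x -> G y -> bowen_dist f n x y < e ->
    \sum_i (L x i != L y i)%:R <= D.
  move=> Gx Gy xye.
  (* The mean of the indicator and its deviation are at most [gm] each; the two orbits together
     account for [4 * gm]. *)
  have visits z : G z -> birkhoff f \1_B0 n z <= n%:R * (2 * gm).
    move=> Gz; have : ~ (n%:R * gm < `|birkhoff f \1_B0 n z - n%:R * mean mu \1_B0|).
      by move=> H; apply: Gz; exists None.
    move/negP; rewrite -leNgt ler_norml => /andP[_].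
    rewrite mean_indic// lerBlDr => H; apply: (le_trans H).
    by rewrite -mulrDr ler_pM2l// -[2]/(1 + 1) mulrDl mul1r lerD2l.
  have -> : D = n%:R * (2 * gm) + n%:R * (2 * gm) by rewrite /D; ring.
  apply: le_trans (lerD (visits x Gx) (visits y Gy)).
  (* Where the names differ, one of the two orbits is outside the cores; otherwise the points would
     lie in distinct cores, at distance at least [e]. *)
  rewrite /birkhoff -big_split/=; apply: ler_sum => i _.
  rewrite !ffunE !add0n !indicE.
  case: (boolP (iter i f x \in B0)) => [_|/negP xB].
    by rewrite (@le_trans _ _ 1)// ?lerDl//; case: (_ != _).
  case: (boolP (iter i f y \in B0)) => [_|/negP yB].
    by rewrite add0r; case: (_ != _).
  rewrite inE in xB; rewrite inE in yB.
  have [j Bj] : exists j, B j (iter i f x).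
    by apply: contrapT => /forallNP H; apply: xB => j _; exact: H.
  have [j' Bj'] : exists j, B j (iter i f y).
    by apply: contrapT => /forallNP H; apply: yB => j' _; exact: H.
  rewrite (Bxi _ _ Bj) (Bxi _ _ Bj'); case: (eqVneq j j') => [_|jj']; first by rewrite addr0.
  have := sepB' j j' jj' _ _ Bj Bj'; rewrite leNgt => /negP; case.
  by apply: le_lt_trans xye; apply: bowen_dist_ge.
have [S [rep [repG repS cardS]]] :=
  @separated_representatives R X f n k L G e a D a0 e_gt0 GD.
set T := [set s | _]%SET in cardS.
have pG : prob mu bad < 1.
  apply: (le_lt_trans pbad); rewrite gt_min; apply/orP; left.
  by rewrite invf_lt1 ?ltr1n.
have T0 : (0 < #|T|)%N.
  have [x Gx] : exists x, G x.
    apply: contrapT => /forallNP H; move: pG.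
    have -> : bad = setT.
      by apply/seteqP; split => // x _; apply: contrapT; exact: H.
    by have [_ -> _] := prob_fa_prob mu; rewrite ltxx.
  by apply/card_gt0P; exists (L x); rewrite inE; apply/asboolP; exists x.
have mL : measurable_label (X := borel X) L.
  exact: (@measurable_itinerary _ (borel X)).
have cP := prob_fa_prob mu.
have Hn : join_entropy f mu xi n <= ln 2 + ln (#|T|%:R) + n%:R * e1.
  rewrite join_entropyE /block_entropy.
  apply: (le_trans (entropy_le_concentrated _ _ T0)).
  - by move=> s; exact: (law_ge0 _ cP mL).
  - exact: (law_sum1 cP mL).
  - rewrite lerD2l (sum_law (fun s => s \notin T) cP mL) card_ffun !card_ord natrX.
    rewrite lnXn// -[ln _ *+ n]mulr_natl mulrCA ler_pM2l//.
    apply: (@le_trans _ _ (dd * ln k%:R)).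
      rewrite ler_wpM2r//; apply: le_trans pbad.
      apply: (fa_prob_le cP) => //; first exact: measurable_label_preimage.
      move=> x /= /negP LT; apply: contrapT => Gx; apply: LT.
      by rewrite inE; apply/asboolP; exists x.
    have : dd * (ln k%:R + 1) <= e1.
      by rewrite -ler_pdivlMr ?ltr_wpDl// ge_min lexx orbT.
    by move: dd0; lra.
have TR : 0 < #|T|%:R :> R by rewrite ltr0n.
have cardS' : #|T|%:R <= #|S|%:R * expR (n%:R * (2 * e1)) :> R.
  apply: (le_trans cardS); rewrite ler_wpM2l//.
  rewrite [n%:R * _](_ : _ = a * D + n%:R * e1).
    rewrite expRD ler_pM2l ?expR_gt0// [n%:R * _]mulrC expRM_natr.
    rewrite lerXn2r ?nnegrE ?addr_ge0 ?mulr_ge0 ?expR_ge0//.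
    by apply: le_trans (expR_ge1Dx _); rewrite lerD2l.
  by rewrite /D /gm; field; rewrite lt0r_neq0.
have S0 : 0 < #|S|%:R :> R.
  rewrite -(pmulr_lgt0 _ (expR_gt0 (n%:R * (2 * e1)))).
  exact: lt_le_trans cardS'.
have lnS : n%:R * (h - 5 * e1) <= ln (#|S|%:R).
  have lnT : ln (#|T|%:R) <= ln (#|S|%:R) + n%:R * (2 * e1).
    rewrite -[X in _ + X]expRK -lnM ?posrE ?expR_gt0// ler_ln ?posrE//.
    by rewrite mulr_gt0 ?expR_gt0.
  move: hn; rewrite ler_pdivlMl// => hn.
  move: (le_trans hn Hn); lra.
have repI : set_inj [set` enum S] rep.
  move=> s s'; rewrite !inE /= !mem_enum => sS s'S ss'.
  by rewrite -(repG s sS).2 -(repG s' s'S).2 ss'.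
apply: le_trans (Nphi_ge (enum_uniq S) repI _).
- rewrite lee_fin big_enum/=.
  apply: (@le_trans _ _ (\sum_(s in S) expR (n%:R * (mean mu phi - e1)))).
    rewrite sumr_const -[expR _ *+ _]mulr_natl.
    rewrite -[X in _ <= X * _]lnK ?posrE// -expRD ler_expR -lerBlDr.
    apply: le_trans lnS; rewrite -mulrBr ler_pM2l// /e1.
    by rewrite le_eqVlt; apply/orP; left; apply/eqP; field.
  apply: ler_sum => s sS; rewrite ler_expR; have [Gs _] := repG s sS.
  have : ~ (n%:R * e1 < `|birkhoff f phi n (rep s) - n%:R * mean mu phi|).
    by move=> H; apply: Gs; exists (Some None).
  move/negP; rewrite -leNgt ler_norml => /andP[H _].
  by rewrite mulrBr; move: H; rewrite lerBrDr addrC.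
- split.
    move=> _ _ [s sS <-] [s' s'S <-] ne; rewrite /= !mem_enum in sS s'S.
    by apply: repS => //; apply/eqP => ss'; apply: ne; rewrite ss'.
  move=> _ [s sS <-]; rewrite /= mem_enum in sS.
  have [Gs _] := repG s sS; apply: Hdl => i.
  rewrite birkhoff_coord [rv _ _ _ _]mxE.
  have : ~ (n%:R * dl < `|birkhoff f (fun y => Phi y ord0 i) n (rep s) -
      n%:R * mean mu (fun y => Phi y ord0 i)|).
    by move=> H; apply: Gs; exists (Some (Some i)).
  move/negP; rewrite -leNgt => H.
  rewrite -(ler_pM2l nR) -[X in X * `|_|](gtr0_norm nR) -normrM mulrBr mulrA.
  by rewrite divff ?mul1r// lt0r_neq0.
Unshelve. all: by end_near. Qed.

End LowerBound.

(** * Ultralimits of positive functionals and their representing measures *)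

Lemma ultra_fmap {T U : Type} (a : T -> U) (F : set_system T) :
  UltraFilter F -> UltraFilter (a @ F).
Proof.
move=> uF; split; first by apply: fmap_proper_filter; exact: ultra_proper.
move=> G pG FG; apply/seteqP; split => [A GA|]; last exact: FG.
have [//|nA] := in_ultra_setVsetC (a @^-1` A) uF.
exfalso; have GnA : G (~` A) by apply: FG.
by apply: (@filter_not_empty _ G _); rewrite -(setICr A); exact: filterI.
Qed.

Lemma ultra_bounded_cvg {R : realType} {T : Type} (F : set_system T) (a : T -> R)
    (M : R) : UltraFilter F -> (\forall n \near F, `|a n| <= M) ->
  a @ F --> lim (a @ F).
Proof.
move=> uF aM; have pF := ultra_proper.
have := @segment_compact R (- M) M; rewrite compact_ultra.
move=> /(_ (a @ F) (ultra_fmap a uF)) [|l [_ /= al]].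
  by apply: filterS aM => n /=; rewrite in_itv/= -ler_norml.
by apply/cvg_ex; exists l.
Qed.

(** The comparison is strict so that, for a continuous function, the superlevel sets counted by the
    sum are open; on open sets [mu] is bounded by the functional. *)
Lemma staircase {R : realType} (N : nat) (t : R) : 0 <= t <= N%:R ->
  \sum_(i < N) (i.+1%:R < t)%R%:R <= t <= \sum_(i < N) (i.+1%:R < t)%R%:R + 1.
Proof.
elim: N => [|N IH].
  by rewrite big_ord0 add0r => /andP[-> t0]; rewrite (le_trans t0).
move=> /andP[t0 tN]; rewrite big_ord_recr/= [_ < t]ltNge tN addr0.
have [tN'|Nt] := leP t N%:R; first by apply: IH; rewrite t0.
rewrite (eq_bigr (fun=> 1)); last first.
  by move=> i _; rewrite (le_lt_trans _ Nt)// ler_nat.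
by rewrite sumr_const card_ord (ltW Nt) natr1.
Qed.

Section PositiveFunctional.
Context {R : realType} {X : pmetricType R}.
Hypothesis X_compact : compact [set: X].
Implicit Types g h : X -> R.

Definition bounded_fct g := exists M, forall x, `|g x| <= M.

(** The functional acts on all bounded functions, not only on continuous ones, so that indicators of
    cells can be evaluated. *)
Record positive_functional (Lam : (X -> R) -> R) : Prop := {
  functionalD : forall g h, bounded_fct g -> bounded_fct h ->
    Lam (g \+ h) = Lam g + Lam h ;
  functionalZ : forall c g, bounded_fct g -> Lam (fun x => c * g x) = c * Lam g ;
  functional_le : forall g h, bounded_fct g -> bounded_fct h ->
    (forall x, g x <= h x) -> Lam g <= Lam h ;
  functional1 : Lam (fun=> 1) = 1 }.

Lemma bounded_fct_cst c : bounded_fct (fun=> c).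
Proof. by exists `|c|. Qed.

Lemma bounded_fct_indic (A : set X) : bounded_fct \1_A.
Proof. by exists 1 => x; rewrite indicE; case: (_ \in _); rewrite ?normr1 ?normr0. Qed.

Lemma bounded_fctD g h : bounded_fct g -> bounded_fct h -> bounded_fct (g \+ h).
Proof.
move=> [M gM] [M' hM']; exists (M + M') => x.
by rewrite (le_trans (ler_normD _ _))// lerD.
Qed.

Lemma bounded_fctZ c g : bounded_fct g -> bounded_fct (fun x => c * g x).
Proof.
by move=> [M gM]; exists (`|c| * M) => x; rewrite normrM ler_wpM2l.
Qed.

Lemma bounded_fct_sum I (s : seq I) (g : I -> X -> R) :
  (forall i, bounded_fct (g i)) -> bounded_fct (fun x => \sum_(i <- s) g i x).
Proof.
move=> bg; elim: s => [|i s IH].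
  rewrite (_ : (fun _ => _) = fun=> 0); first exact: bounded_fct_cst.
  by apply/funext => x; rewrite big_nil.
rewrite (_ : (fun _ => _) = g i \+ (fun x => \sum_(j <- s) g j x)).
  exact: bounded_fctD.
by apply/funext => x; rewrite big_cons.
Qed.

Variable Lam : (X -> R) -> R.
Hypothesis pLam : positive_functional Lam.

Lemma functional_cst c : Lam (fun=> c) = c.
Proof.
rewrite (_ : (fun=> c) = fun x : X => c * 1); last by apply/funext => x; rewrite mulr1.
by rewrite (functionalZ pLam)// ?(functional1 pLam) ?mulr1//; exact: bounded_fct_cst.
Qed.

Lemma functional_sum I (s : seq I) (g : I -> X -> R) :
  (forall i, bounded_fct (g i)) ->
  Lam (fun x => \sum_(i <- s) g i x) = \sum_(i <- s) Lam (g i).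
Proof.
move=> bg; elim: s => [|i s IH].
  rewrite big_nil -[RHS]functional_cst; congr Lam.
  by apply/funext => x; rewrite big_nil.
rewrite big_cons -IH -(functionalD pLam)//; last exact: bounded_fct_sum.
by congr Lam; apply/funext => x; rewrite big_cons.
Qed.

Let lam (A : set X) := Lam \1_A.

Let lam_ge0 A : 0 <= lam A.
Proof.
rewrite -[0](functional_cst 0); apply: (functional_le pLam) => //.
- exact: bounded_fct_cst.
- exact: bounded_fct_indic.
Qed.

Let lamT : lam setT = 1.
Proof.
rewrite -(functional1 pLam); congr Lam; apply/funext => x.
by rewrite indicE in_setT.
Qed.

Let lamU A B : A `&` B = set0 -> lam (A `|` B) = lam A + lam B.
Proof.
move=> AB; rewrite /lam -(functionalD pLam); try exact: bounded_fct_indic.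
congr Lam; apply/funext => x; rewrite /= !indicE in_setU.
case: (boolP (x \in A)) => xA; case: (boolP (x \in B)) => xB //=; rewrite ?addr0 ?add0r//.
by have : (A `&` B) x by [rewrite !inE in xA xB]; rewrite AB.
Qed.

Lemma functional_indic_le (A B : set X) : A `<=` B -> Lam \1_A <= Lam \1_B.
Proof.
move=> AB; apply: (functional_le pLam); try exact: bounded_fct_indic.
move=> x; rewrite !indicE ler_nat; case: (boolP (x \in A)) => // xA.
by rewrite mem_set//; apply: AB; rewrite inE in xA.
Qed.

(* Comparing g with the staircase of its superlevel sets: both functionals are
   within 1/N of the average of the measures of these sets. *)
Let mean_le_functional (mu : probability (borel X) R) g N :
  (forall U, open U -> prob mu U <= lam U) -> continuous g ->
  (forall x, 0 <= g x <= 1) -> (0 < N)%N -> mean mu g <= Lam g + N%:R^-1.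
Proof.
move=> muU cg g01 N0.
have NR : 0 < N%:R :> R by rewrite ltr0n.
pose A (i : 'I_N) : set X := [set x | i.+1%:R < N%:R * g x].
have oA i : open (A i).
  rewrite (_ : A i = g @^-1` `]i.+1%:R / N%:R, +oo[%classic).
    by move/continuousP : cg => /(_ _ (interval_open _ _)); exact.
  by apply/seteqP; split => x /=; rewrite in_itv/= andbT ltr_pdivrMr// mulrC.
have bA i : bounded_measurable (\1_(A i) : borel X -> R).
  by apply: bounded_measurable_indic; exact: borel_open.
have gE x : \sum_i \1_(A i) x <= N%:R * g x <= \sum_i \1_(A i) x + 1.
  rewrite (eq_bigr (fun i : 'I_N => (i.+1%:R < N%:R * g x)%R%:R)).
    apply: staircase; have /andP[g0 g1] := g01 x.
    by rewrite mulr_ge0//= ger_pMr.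
  move=> i _; rewrite indicE.
  by have -> : (x \in A i) = (i.+1%:R < N%:R * g x) by apply/idP/idP; rewrite inE.
have bsum : bounded_measurable (fun x : borel X => \sum_i \1_(A i) x).
  exact: bounded_measurable_sum.
have bg : bounded_measurable (g : borel X -> R) by exact: continuous_bounded_measurable.
apply: (@le_trans _ _ (N%:R^-1 * mean mu (fun x => \sum_i \1_(A i) x) + N%:R^-1)).
  have b1 : bounded_measurable (fun x : borel X => N%:R^-1 * \sum_i \1_(A i) x).
    exact: bounded_measurableZ.
  rewrite -meanZ// -[X in _ + X](mean_cst mu) -meanD//; last exact: bounded_measurable_cst.
  apply: mean_le => //.
    by apply: bounded_measurableD => //; exact: bounded_measurable_cst.
  move=> x /=; have /andP[_ gx] := gE x.
  by rewrite -[X in _ + X]mulr1 -mulrDr ler_pdivlMl.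
rewrite lerD2r mean_sum//.
have bgf : bounded_fct g by case: bg.
apply: (@le_trans _ _ (N%:R^-1 * Lam (fun x => \sum_i \1_(A i) x))).
  rewrite ler_pM2l ?invr_gt0// functional_sum; last by move=> i; exact: bounded_fct_indic.
  by apply: ler_sum => i _; rewrite mean_indic ?muU//; exact: borel_open.
rewrite -(functionalZ pLam); last by apply: bounded_fct_sum => i; exact: bounded_fct_indic.
apply: (functional_le pLam) => //.
  by apply: bounded_fctZ; apply: bounded_fct_sum => i; exact: bounded_fct_indic.
by move=> x; have /andP[gx _] := gE x; rewrite ler_pdivrMl.
Qed.

Let functional_comp1 g : bounded_fct g -> Lam (fun x => 1 - g x) = 1 - Lam g.
Proof.
move=> bg; rewrite (_ : (fun _ => _) = (fun=> 1) \+ (fun x => -1 * g x)).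
  rewrite (functionalD pLam) ?functional_cst ?(functionalZ pLam) ?mulN1r//.
    exact: bounded_fct_cst.
  exact: bounded_fctZ.
by apply/funext => x /=; rewrite mulN1r.
Qed.

(** [mean_le_functional] gives one inequality in the limit of fine staircases; applied to [1 - g] it
    gives the other. *)
Let mean_functional01 (mu : probability (borel X) R) g :
  (forall U, open U -> prob mu U <= lam U) -> continuous g ->
  (forall x, 0 <= g x <= 1) -> mean mu g = Lam g.
Proof.
move=> muU cg g01.
have le h : continuous h -> (forall x, 0 <= h x <= 1) -> mean mu h <= Lam h.
  move=> ch h01; apply/ler_addgt0Pr => e e0.
  apply: le_trans (mean_le_functional muU ch h01 (ltn0Sn (Num.trunc e^-1))) _.
  by rewrite lerD2l invf_ple ?posrE//; exact: ltW (truncnS_gt _).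
have bg : bounded_measurable (g : borel X -> R) by exact: continuous_bounded_measurable.
apply/eqP; rewrite eq_le le//=.
have : mean mu (fun x => 1 - g x) <= Lam (fun x => 1 - g x).
  apply: le => [x|x]; first by apply: cvgB; [exact: cvg_cst|exact: cg].
  by have /andP[g0 g1] := g01 x; rewrite subr_ge0 g1 gerBl.
rewrite functional_comp1; last by case: bg.
rewrite (_ : (fun _ => _) = (fun=> 1) \+ (fun x => -1 * g x)); last first.
  by apply/funext => x /=; rewrite mulN1r.
rewrite meanD; [|exact: bounded_measurable_cst|exact: bounded_measurableZ].
by rewrite mean_cst meanZ// mulN1r lerD2l lerN2.
Qed.

(** Equality is claimed on continuous functions, which are rescaled to take values in [0, 1]. The
    one-sided bounds on closed and open sets are those of the portmanteau theorem, and the last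
    clause records the construction for the proof of invariance. *)
Lemma riesz : exists mu : probability (borel X) R,
  [/\ forall g, continuous g -> mean mu g = Lam g,
      forall K, closed K -> Lam \1_K <= prob mu K,
      forall U, open U -> prob mu U <= Lam \1_U &
      forall U : set X, open U ->
        mu U = inner_content (fun A => Lam \1_A) U].
Proof.
have [mu [muU muK]] := content_to_probability X_compact lam_ge0 lamT lamU.
have probU U : open U -> prob mu U <= Lam \1_U.
  move=> oU; rewrite -lee_fin -probE; last exact: borel_open.
  rewrite muU//; apply: ge_ereal_sup => _ [K [_ KU] <-].
  by rewrite lee_fin functional_indic_le.
exists mu; split => //; last first.
  by move=> K cK; rewrite -lee_fin -probE ?muK//; exact: borel_closed.
move=> g cg.
have bg : bounded_measurable (g : borel X -> R) by exact: continuous_bounded_measurable.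
have [_ [M gM]] := bg.
pose c := 2 * (`|M| + 1); have c0 : 0 < c by rewrite mulr_gt0// ltr_wpDl.
pose h x := c^-1 * g x + 2^-1.
have ch : continuous h.
  move=> x; apply: cvgD; last exact: cvg_cst.
  by apply: cvgM; [exact: cvg_cst|exact: cg].
have h01 x : 0 <= h x <= 1.
  have : `|c^-1 * g x| <= 2^-1.
    rewrite normrM gtr0_norm ?invr_gt0// ler_pdivrMl//.
    rewrite /c mulrAC mulfV ?mul1r ?pnatr_eq0// (le_trans (gM x))//.
    by rewrite (le_trans (ler_norm _))// lerDl.
  by rewrite /h ler_norml; lra.
have hE : (h : borel X -> R) = (fun x => c^-1 * g x) \+ (fun=> 2^-1) by [].
have := mean_functional01 probU ch h01.
rewrite [in LHS]hE meanD; [|exact: bounded_measurableZ|exact: bounded_measurable_cst].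
rewrite [in RHS]hE (functionalD pLam);
  [|by case: (bounded_measurableZ c^-1 bg)|exact: bounded_fct_cst].
rewrite meanZ// (functionalZ pLam); last by exists M.
rewrite mean_cst functional_cst => /addIr /mulfI; apply.
by rewrite invr_eq0 lt0r_neq0.
Qed.

End PositiveFunctional.

Section UltraLimit.
Context {R : realType} {X : pmetricType R} (U : set_system nat).
Hypothesis uU : UltraFilter U.
Variable Lam_ : nat -> (X -> R) -> R.
Hypothesis pLam : \forall n \near U, positive_functional (Lam_ n).

Let pU : ProperFilter U := ultra_proper.

Definition ultralimit (g : X -> R) : R := lim (Lam_ n g @[n --> U]).

Lemma ultralimit_cvg g : bounded_fct g -> Lam_ n g @[n --> U] --> ultralimit g.
Proof.
move=> [M gM]; apply: (@ultra_bounded_cvg _ _ _ _ M).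
apply: filterS pLam => n pn.
have bg : bounded_fct g by exists M.
rewrite ler_norml; apply/andP; split.
  rewrite -(functional_cst pn (- M)); apply: (functional_le pn) => //.
    exact: bounded_fct_cst.
  by move=> x; have := gM x; rewrite ler_norml => /andP[].
rewrite -[leRHS](functional_cst pn M); apply: (functional_le pn) => //.
  exact: bounded_fct_cst.
by move=> x; have := gM x; rewrite ler_norml => /andP[].
Qed.

Lemma ultralimit_eq g l : Lam_ n g @[n --> U] --> l -> ultralimit g = l.
Proof. by move=> /cvg_lim; apply; exact: Rhausdorff. Qed.

Lemma ultralimit_positive : positive_functional ultralimit.
Proof.
split.
- move=> g h bg bh; apply: ultralimit_eq.
  apply: cvg_trans (cvgD (ultralimit_cvg bg) (ultralimit_cvg bh)).
  apply: near_eq_cvg; apply: filterS pLam => n pn /=.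
  by rewrite (functionalD pn).
- move=> c g bg; apply: ultralimit_eq.
  apply: cvg_trans (cvgM (cvg_cst c) (ultralimit_cvg bg)).
  apply: near_eq_cvg; apply: filterS pLam => n pn /=.
  by rewrite (functionalZ pn).
- move=> g h bg bh gh; apply: ler_lim.
  + exact: cvgP (ultralimit_cvg bg).
  + exact: cvgP (ultralimit_cvg bh).
  + by apply: filterS pLam => n pn; exact: (functional_le pn).
- apply: ultralimit_eq; apply: cvg_trans (@cvg_cst _ (1 : R) _ U _).
  apply: near_eq_cvg; apply: filterS pLam => n pn /=.
  by rewrite (functional1 pn).
Qed.

End UltraLimit.

Section InvariantFunctional.
Context {R : realType} {X : pmetricType R} (f : X -> X) (Lam : (X -> R) -> R).
Hypotheses (X_compact : compact [set: X]) (f_continuous : continuous f).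
Hypothesis fLam : forall g, bounded_fct g -> Lam (g \o f) = Lam g.
Hypothesis pLam : positive_functional Lam.
Variable mu : probability (borel X) R.
Hypothesis muE : forall U : set X, open U ->
  mu U = inner_content (fun A => Lam \1_A) U.

Let indic_comp (A : set X) : \1_(f @^-1` A) = (\1_A : X -> R) \o f.
Proof. by apply/funext => x; rewrite /= !indicE; congr (_%:R); rewrite !inE_set. Qed.

(** Closed sets are transferred both ways: one inside the preimage of [U] to its image, which is
    compact, and one inside [U] to its preimage, whose indicator has the same value under [Lam]. *)
Let open_invariant U : open U -> mu (f @^-1` U) = mu U.
Proof.
move=> oU; have oV : open (f @^-1` U) by move/continuousP : f_continuous; exact.
rewrite !muE//; apply/eqP; rewrite eq_le; apply/andP; split.
  apply: ge_ereal_sup => _ [K [cK KU] <-]; apply: ereal_sup_ge.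
  exists (Lam \1_(f @` K))%:E.
    exists (f @` K) => //; split; last by move=> _ [x /KU Ux <-].
    apply: (@compact_closed X); first exact: metric_hausdorff.
    apply: continuous_compact.
      exact: continuous_subspaceT.
    exact: subclosed_compact X_compact _.
  rewrite lee_fin -[leRHS]fLam; last exact: bounded_fct_indic.
  rewrite -indic_comp; apply: (functional_indic_le pLam) => x Kx.
  by exists x.
apply: ge_ereal_sup => _ [K [cK KU] <-]; apply: ereal_sup_ubound.
exists (f @^-1` K); last by rewrite indic_comp fLam//; exact: bounded_fct_indic.
split; last exact: preimage_subset.
by apply: closed_comp => // x _; exact: f_continuous.
Qed.

Lemma functional_invariant : invariant_measure f mu.
Proof.
have mf := continuous_borel f_continuous.
have mff : measurable_fun setT (f : borel X -> borel X).
  by move=> _ A mA; rewrite setTI; exact: mf.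
pose nu := measure_function_pushforward__canonical__measure_function_Measure mu mff.
move=> A mA; rewrite -[LHS]/(nu A).
apply: (@measure_unique _ R (borel X) (@open X) (fun=> setT) _ _ _ _ nu mu) => //.
- by move=> B C; exact: openI.
- by move=> _; exact: openT.
- by rewrite bigcup_const//; exists 0.
- move=> _; rewrite -[nu _]/(mu setT).
  by rewrite -ge0_fin_numE ?fin_num_measure.
Qed.

End InvariantFunctional.

(** * Sets with null boundary and fine partitions into such sets *)

Section Jordan.
Context {R : realType} {X : pmetricType R} (mu : probability (borel X) R).

(** These are the continuity sets of [mu]. Asking for some [U] and [K], instead of the interior and
    the closure, makes stability under set operations and preimages direct. *)
Definition jordan (A : set X) := exists U K : set X,
  [/\ open U, closed K, U `<=` A, A `<=` K & prob mu (K `\` U) = 0].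

Let cP := prob_fa_prob mu.

Lemma jordanC A : jordan A -> jordan (~` A).
Proof.
move=> [U [K [oU cK UA AK KU]]]; exists (~` K), (~` U); split.
- exact: closed_openC.
- exact: open_closedC.
- exact: subsetC.
- exact: subsetC.
- by rewrite setDE setCK setIC -setDE.
Qed.

Lemma jordanI A B : jordan A -> jordan B -> jordan (A `&` B).
Proof.
move=> [U [K [oU cK UA AK KU]]] [V [L [oV cL VB BL LV]]].
have mU := borel_open oU; have mV := borel_open oV.
have mK := borel_closed cK; have mL := borel_closed cL.
exists (U `&` V), (K `&` L); split.
- exact: openI.
- exact: closedI.
- exact: setISS.
- exact: setISS.
- apply/eqP; rewrite eq_le; apply/andP; split; last by rewrite fine_ge0.
  rewrite -[0]addr0 -{1}KU -LV.
  apply: (@le_trans _ _ (prob mu (K `\` U `|` L `\` V))).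
    apply: (fa_prob_le cP).
    + by apply: measurableD; exact: measurableI.
    + by apply: measurableU; exact: measurableD.
    + move=> x [[Kx Lx] nUV]; have [Ux|nUx] := pselect (U x); last by left.
      by right; split => // Vx; apply: nUV.
  by apply: probU_le; exact: measurableD.
Qed.

Lemma jordanT : jordan setT.
Proof.
exists setT, setT; split; [exact: openT|exact: closedT|by []|by []|].
by rewrite setDv (fa_prob0 cP).
Qed.

Lemma jordan_bigcap (I : finType) (F : I -> set X) :
  (forall i, jordan (F i)) -> jordan (\bigcap_i F i).
Proof.
move=> jF; suff H (s : seq I) : jordan (\bigcap_(i in [set` s]) F i).
  have := H (index_enum I); rewrite (_ : [set` index_enum I] = setT)//.
  by apply/seteqP; split => i //= _; rewrite mem_index_enum.
elim: s => [|i s IH].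
  by rewrite set_nil bigcap_set0; exact: jordanT.
have -> : \bigcap_(j in [set` i :: s]) F j = F i `&` \bigcap_(j in [set` s]) F j.
  apply/seteqP; split => x.
    move=> Fx; split; first by apply: Fx; rewrite /= inE eqxx.
    by move=> j /= js; apply: Fx; rewrite /= inE js orbT.
  by move=> [Fi Fs] j /=; rewrite inE => /orP[/eqP -> //|]; exact: Fs.
exact: jordanI.
Qed.

Lemma jordan_preimage (f : X -> X) A : continuous f -> invariant_measure f mu ->
  jordan A -> jordan (f @^-1` A).
Proof.
move=> cf imu [U [K [oU cK UA AK KU]]].
exists (f @^-1` U), (f @^-1` K); split.
- by move/continuousP : cf; exact.
- by apply: closed_comp => // x _; exact: cf.
- exact: preimage_subset.
- exact: preimage_subset.
- rewrite -[_ `\` _]/(f @^-1` (K `\` U)) /prob imu//.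
  by apply: measurableD; [exact: borel_closed|exact: borel_open].
Qed.

Lemma jordan_iter (f : X -> X) n A : continuous f -> invariant_measure f mu ->
  jordan A -> jordan (iter n f @^-1` A).
Proof.
move=> cf imu; elim: n A => [//|n IH] A jA.
rewrite (_ : iter n.+1 f @^-1` A = iter n f @^-1` (f @^-1` A))//.
by apply: IH; exact: jordan_preimage.
Qed.

(** Both values are squeezed between [prob mu U] and [prob mu K], which coincide. *)
Lemma jordan_functional (Lam : (X -> R) -> R) (A : set (borel X)) :
  positive_functional Lam ->
  (forall K : set X, closed K -> Lam \1_K <= prob mu K) ->
  (forall U : set X, open U -> prob mu U <= Lam \1_U) ->
  measurable A -> jordan A -> Lam \1_A = prob mu A.
Proof.
move=> pLam LK LU mA [U [K [oU cK UA AK KU]]].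
have mU := borel_open oU; have mK := borel_closed cK.
have KUE : prob mu K = prob mu U.
  have UK : U `<=` K by exact: subset_trans AK.
  rewrite -(setDUK UK); case: cP => _ _ ->//; first by rewrite KU addr0.
    exact: measurableD.
  by rewrite setDIK.
apply/eqP; rewrite eq_le; apply/andP; split.
  rewrite (le_trans (functional_indic_le pLam AK))// (le_trans (LK _ cK))//.
  by rewrite KUE (fa_prob_le cP).
rewrite (le_trans _ (functional_indic_le pLam UA))// (le_trans _ (LU _ oU))//.
by rewrite -KUE (fa_prob_le cP).
Qed.

Lemma closed_mdist (x : X) (r : R) : closed [set y | mdist x y <= r].
Proof.
rewrite -openC openE => y /= /negP; rewrite -ltNge => xy.
rewrite /interior -nbhs_ballE; exists (mdist x y - r) => /=; first by rewrite subr_gt0.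
move=> z; rewrite ballEmdist /= => yz; apply/negP; rewrite -ltNge.
by have := metric_triangle x z y; rewrite [mdist z y]metric_sym; lra.
Qed.

(** Spheres of different radii are disjoint, so finitely many have mass above [1/(n+1)] and
    countably many have positive mass, whereas the interval is uncountable. *)
Lemma null_sphere (x : X) (a b : R) : a < b ->
  exists2 s, a < s < b & prob mu [set y | mdist x y = s] = 0.
Proof.
move=> ab; apply: contrapT => nex.
pose S s : set (borel X) := [set y | mdist x y = s].
have mS s : measurable (S s).
  rewrite (_ : S s = [set y | mdist x y <= s] `\` [set y | mdist x y < s]).
    apply: measurableD; [apply: borel_closed|apply: borel_open].
      exact: closed_mdist.
    exact: open_mdist.
  apply/seteqP; split => y; rewrite /S /=.
    by move=> ->; split; rewrite ?lexx ?ltxx.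
  by move=> [xy /negP]; rewrite -leNgt => sx; apply/eqP; rewrite eq_le xy sx.
have Spos s : a < s < b -> 0 < prob mu (S s).
  move=> sab; rewrite lt_def fine_ge0// andbT; apply/eqP => S0; apply: nex.
  by exists s.
pose A n := [set s | a < s < b /\ n.+1%:R^-1 < prob mu (S s)].
have fA n : finite_set (A n).
  apply: contrapT => /(infinite_set_fset n.+2)[B BA nB].
  have [mB PB] := @label_preimage _ (borel X) R R (prob mu) (mdist x)
    (finmap.enum_fset B) cP mS (finmap.fset_uniq B).
  have : prob mu (mdist x @^-1` [set` finmap.enum_fset B]) <= 1.
    by case: (cP) => _ <- _; apply: (fa_prob_le cP).
  rewrite leNgt PB => /negP; apply.
  apply: (@lt_le_trans _ _ (\sum_(s <- finmap.enum_fset B) n.+1%:R^-1)).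
    rewrite big_const_seq count_predT iter_addr_0 -[X in 1 < X]mulr_natl.
    by rewrite ltr_pdivlMr ?ltr0n// mul1r ltr_nat.
  rewrite big_seq [leRHS]big_seq; apply: ler_sum => s sB.
  by have [_ /ltW] := BA s sB.
have : countable `]a, b[%classic.
  apply: (@sub_countable _ _ _ (\bigcup_n A n)); last first.
    by apply: bigcup_countable => // n _; exact: finite_set_countable.
  apply: subset_card_le => s /=; rewrite in_itv /= => sab.
  have := Spos s sab => S0.
  exists (Num.trunc (prob mu (S s))^-1) => //; split => //.
  by rewrite invf_plt ?posrE//; exact: truncnS_gt.
move=> /countable_lebesgue_measure0; rewrite lebesgue_measure_itv/= lte_fin ab.
by rewrite -EFinD => -[] /eqP; rewrite subr_eq0 => /eqP ba; rewrite ba ltxx in ab.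
Qed.

(* The cells are differences of balls with null spheres. *)
Lemma small_jordan_partition (e : R) : compact [set: X] -> 0 < e ->
  exists k (xi : borel X -> 'I_k), [/\ measurable_partition xi,
    forall j, jordan (xi @^-1` [set j]) &
    forall x y, xi x = xi y -> mdist x y < e].
Proof.
move=> kX e0.
have /choice[s Hs] : forall x : X, exists s, 0 < s /\ s < e / 2 /\
    prob mu [set y | mdist x y = s] = 0.
  move=> x; have [|s /andP[s0 se] S0] := @null_sphere x 0 (e / 2).
    by rewrite divr_gt0.
  by exists s.
pose V x : set X := [set y | mdist x y < s x].
have mV x : measurable (V x : set (borel X)).
  by apply: borel_open; exact: open_mdist.
have jV x : jordan (V x).
  exists (V x), [set y | mdist x y <= s x]; split => //.
  - exact: open_mdist.
  - exact: closed_mdist.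
  - by move=> y /ltW.
  - have [_ [_ <-]] := Hs x; congr prob; apply/seteqP; split => y; rewrite /V /=.
      by move=> [xy /negP]; rewrite -leNgt => sx; apply/eqP; rewrite eq_le xy sx.
    by move=> ->; split; rewrite ?lexx ?ltxx.
move: kX; rewrite compact_cover => /(_ X setT V (fun x _ => open_mdist x (s x))).
case=> [x _|D _ DV]; first by exists x => //; rewrite /V /= mdistxx; case: (Hs x).
pose l := finmap.enum_fset D.
pose p y x := mdist x y < s x.
have hasl y : (find (p y) l < size l)%N.
  rewrite -has_find; have [x /= xD xy] := DV y I; apply/hasP; exists x => //.
have nthl y : p y (nth point l (find (p y) l)).
  by apply: (@nth_find _ point); rewrite has_find.
(* The label is the index of the first ball of the finite subcover that contains [y]. *)
pose xi (y : borel X) : 'I_(size l) := Ordinal (hasl y).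
have xiE (j : 'I_(size l)) : xi @^-1` [set j] =
    V (nth point l j) `&` \bigcap_(i : 'I_(size l))
      (if (i < j)%N then ~` V (nth point l i) else setT).
  apply/seteqP; split => y /=.
    move=> <-; split; first exact: nthl.
    move=> i _; case: ifPn => // ij Vy.
    by have := before_find point ij; rewrite /p => /negP; apply.
  move=> [Vj Vi]; apply/val_inj => /=; apply/eqP; rewrite eqn_leq; apply/andP; split.
    rewrite leqNgt; apply/negP => jl; have := before_find point jl.
    by rewrite /p => /negP; apply.
  rewrite leqNgt; apply/negP => lj; have := Vi (Ordinal (hasl y)) I.
  by rewrite /= lj; apply; exact: nthl.
exists (size l), xi; split.
- move=> j; rewrite xiE; apply: measurableI => //.
  apply: fin_bigcap_measurable => // i _; case: ifP => // _.
  by apply: measurableC.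
- move=> j; rewrite xiE; apply: jordanI => //; apply: jordan_bigcap => i.
  by case: ifP => // _; [exact: jordanC|exact: jordanT].
- move=> x y /(congr1 val) /= xy.
  pose z := nth point l (find (p x) l).
  have Vx : mdist z x < s z by exact: nthl.
  have Vy : mdist z y < s z by rewrite /z xy; exact: nthl.
  have [_ [se _]] := Hs z; rewrite (le_lt_trans (metric_triangle x z y))//.
  by rewrite (metric_sym x); lra.
Qed.

End Jordan.

(* Stands in for the continuity of [x ln x] at 0 when entropies pass to the
   limit: the cross entropy against fixed positive weights is linear in [p]. *)
Lemma entropy_approx {R : realType} (T : finType) (p : T -> R) (e : R) :
  (forall t, 0 <= p t) -> \sum_t p t = 1 -> 0 < e ->
  exists q : T -> R, [/\ forall t, 0 < q t, \sum_t q t <= 1 &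
    - \sum_t p t * ln (q t) <= entropy p + e].
Proof.
move=> p0 p1 e0; have K0 : 0 < 1 + #|T|%:R :> R by rewrite ltr_wpDr.
(* Adding [d] to every weight and normalizing by [D] costs at most [ln D <= d * #|T| <= e]. *)
pose d := e / (1 + #|T|%:R); have d0 : 0 < d by rewrite divr_gt0.
pose D := 1 + d * #|T|%:R; have D0 : 0 < D by rewrite ltr_wpDr// mulr_ge0// ltW.
have pd t : 0 < p t + d by rewrite ltr_wpDl.
exists (fun t => (p t + d) / D); split.
- by move=> t; rewrite divr_gt0.
- rewrite -mulr_suml big_split/= p1 sumr_const -[_ *+ _]mulr_natr.
  by rewrite divff// lt0r_neq0.
- have -> : \sum_t p t * ln ((p t + d) / D) = \sum_t p t * ln (p t + d) - ln D.
    rewrite -[X in _ - X]mul1r -p1 mulr_suml -sumrB; apply: eq_bigr => t _.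
    by rewrite ln_div ?posrE// mulrBr.
  rewrite opprB addrC; apply: lerD.
    rewrite lerN2; apply: ler_sum => t _.
    have [->|pt0] := eqVneq (p t) 0; first by rewrite !mul0r.
    have pt : 0 < p t by rewrite lt_def pt0 p0.
    by rewrite ler_pM2l// ler_ln ?posrE// lerDl ltW.
  apply: le_trans (le_ln1Dx _) _.
    by rewrite (lt_le_trans (ltrN10 _))// mulr_ge0// ltW.
  by rewrite /d mulrAC ler_pdivrMr// ler_pM2l// lerDr.
Qed.

Lemma functional_label {R : realType} {X : pmetricType R} (Lam : (X -> R) -> R)
    (T : finType) (L : X -> T) (F : T -> R) : positive_functional Lam ->
  Lam (fun x => F (L x)) = \sum_t law (X := borel X) (fun A => Lam \1_A) L t * F t.
Proof.
move=> pLam.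
have -> : (fun x => F (L x)) = (fun x => \sum_t F t * \1_(L @^-1` [set t]) x).
  apply/funext => x; rewrite (bigD1 (L x))//= indicE mem_set// mulr1 big1 ?addr0//.
  move=> t tL; rewrite indicE memNset ?mulr0//= => Lt.
  by rewrite Lt eqxx in tL.
rewrite (functional_sum pLam); last first.
  by move=> t; apply: bounded_fctZ; exact: bounded_fct_indic.
apply: eq_bigr => t _; rewrite (functionalZ pLam) 1?mulrC//.
exact: bounded_fct_indic.
Qed.

(** * Gibbs-weighted empirical averages and Misiurewicz's estimate *)

Section Empirical.
Context {R : realType} {X : pmetricType R} (f : X -> X).
Variables (s : seq X) (p : X -> R).
Hypotheses (s_uniq : uniq s) (p_ge0 : forall x, 0 <= p x).
Hypothesis p_sum1 : \sum_(x <- s) p x = 1.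

Definition point_masses (A : set X) : R := \sum_(x <- s) p x * \1_A x.

Definition empirical n (g : X -> R) : R :=
  n%:R^-1 * \sum_(k < n) \sum_(x <- s) p x * g (iter k f x).

Lemma empirical_positive n : (0 < n)%N -> positive_functional (empirical n).
Proof.
move=> n0; split.
- move=> g h _ _; rewrite /empirical -mulrDr -big_split/=; congr (_ * _).
  apply: eq_bigr => k _; rewrite -big_split/=; apply: eq_bigr => x _.
  by rewrite mulrDr.
- move=> c g _; rewrite /empirical mulrCA; congr (_ * _); rewrite mulr_sumr.
  apply: eq_bigr => k _; rewrite mulr_sumr; apply: eq_bigr => x _.
  by rewrite mulrCA.
- move=> g h _ _ gh; rewrite /empirical ler_wpM2l ?invr_ge0//.
  by apply: ler_sum => k _; apply: ler_sum => x _; rewrite ler_wpM2l.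
- rewrite /empirical; under eq_bigr do under eq_bigr do rewrite mulr1.
  under eq_bigr do rewrite p_sum1.
  by rewrite sumr_const card_ord mulVf// pnatr_eq0 -lt0n.
Qed.

(** The time sums telescope to two boundary terms. The bound holds for every bounded [g], so the
    ultralimit is invariant on all bounded functions. *)
Lemma empirical_comp n g M : (forall x, `|g x| <= M) ->
  `|empirical n (g \o f) - empirical n g| <= n%:R^-1 * (2 * M).
Proof.
move=> gM; rewrite /empirical -mulrBr normrM ger0_norm ?invr_ge0//.
rewrite ler_wpM2l ?invr_ge0//.
pose a k := \sum_(x <- s) p x * g (iter k f x).
have aM k : `|a k| <= M.
  rewrite (le_trans (ler_norm_sum _ _ _))//.
  apply: (@le_trans _ _ (\sum_(x <- s) p x * M)); last by rewrite -mulr_suml p_sum1 mul1r.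
  by apply: ler_sum => x _; rewrite normrM ger0_norm// ler_wpM2l.
have -> : \sum_(k < n) \sum_(x <- s) p x * (g \o f) (iter k f x) -
    \sum_(k < n) \sum_(x <- s) p x * g (iter k f x) = a n - a 0%N.
  rewrite -sumrB -(big_mkord xpredT (fun k => a k.+1 - a k)).
  by rewrite telescope_sumr.
by rewrite (le_trans (ler_normB _ _))// mulr_natl mulr2n lerD.
Qed.

Lemma empirical_birkhoff n g :
  empirical n g = \sum_(x <- s) p x * (n%:R^-1 * birkhoff f g n x).
Proof.
rewrite /empirical exchange_big/= mulr_sumr; apply: eq_bigr => x _.
by rewrite -mulr_sumr mulrCA.
Qed.

Lemma point_masses_fa_prob : fa_prob (X := borel X) point_masses.
Proof.
split.
- by move=> A _; apply: sumr_ge0 => x _; rewrite mulr_ge0// indicE.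
- rewrite /point_masses -p_sum1; apply: eq_bigr => x _.
  by rewrite indicE in_setT mulr1.
- move=> A B _ _ AB; rewrite /point_masses -big_split/=; apply: eq_bigr => x _.
  rewrite -mulrDr; congr (_ * _); rewrite !indicE in_setU.
  case: (boolP (x \in A)) => xA; case: (boolP (x \in B)) => xB //=; rewrite ?addr0 ?add0r//.
  by have : (A `&` B) x by [rewrite !inE in xA xB]; rewrite AB.
Qed.

Lemma entropy_point_masses (T : finType) (L : X -> T) :
  {in s &, injective L} ->
  entropy (law (X := borel X) point_masses L) = - \sum_(x <- s) p x * ln (p x).
Proof.
move=> Linj; congr (- _).
pose q := law (X := borel X) point_masses L.
have qE t : q t = \sum_(x <- s) p x * (L x == t)%:R.
  apply: eq_bigr => x _; congr (_ * _); rewrite indicE; congr ((nat_of_bool _)%:R).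
  by apply/idP/idP => [|/eqP Lx]; rewrite inE //= => /eqP.
transitivity (\sum_(x <- s) p x * ln (q (L x))).
  transitivity (\sum_t \sum_(x <- s) p x * (L x == t)%:R * ln (q t)).
    by apply: eq_bigr => t _; rewrite -mulr_suml -qE.
  rewrite exchange_big/=; apply: eq_bigr => x _.
  rewrite (bigD1 (L x))//= eqxx mulr1 big1 ?addr0// => t tL.
  by rewrite eq_sym (negbTE tL) mulr0 mul0r.
rewrite big_seq [RHS]big_seq; apply: eq_bigr => x xs; congr (_ * ln _).
rewrite qE (bigD1_seq x)//= eqxx mulr1 big_seq_cond big1 ?addr0// => y.
move=> /andP[ys yx]; rewrite (_ : L y == L x = false) ?mulr0//.
by apply/negbTE; apply: contra yx => /eqP /Linj ->.
Qed.

End Empirical.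

Section Misiurewicz.
Context {R : realType} {X : pmetricType R} (f : X -> X) (phi : X -> R).
Hypothesis f_continuous : continuous f.
Let mf := continuous_borel f_continuous.

(** These are the equilibrium weights on [s]: they maximize entropy plus the mean of the Birkhoff
    sum, with maximum the logarithm of the normalizing sum. *)
Definition gibbs_weight (s : seq X) n (x : X) : R :=
  expR (birkhoff f phi n x) / \sum_(y <- s) expR (birkhoff f phi n y).

Variables (s : seq X) (n : nat).
Hypotheses (s_uniq : uniq s) (n_gt0 : (0 < n)%N).
Let Z := \sum_(y <- s) expR (birkhoff f phi n y).
Hypothesis Z_gt0 : 0 < Z.
Let p := gibbs_weight s n.

Lemma gibbs_weight_ge0 x : 0 <= p x.
Proof. by rewrite divr_ge0 ?expR_ge0// ltW. Qed.

Lemma gibbs_weight_sum1 : \sum_(x <- s) p x = 1.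
Proof. by rewrite -mulr_suml divff// lt0r_neq0. Qed.

(** [ln (p x)] is the Birkhoff sum at [x] minus [ln Z]; averaging over [p] gives equality. *)
Lemma gibbs_variational (T : finType) (L : X -> T) : {in s &, injective L} ->
  ln Z = entropy (law (X := borel X) (point_masses s p) L) +
    n%:R * empirical f s p n phi.
Proof.
move=> Linj; rewrite (entropy_point_masses p s_uniq Linj).
have nR : n%:R != 0 :> R by rewrite pnatr_eq0 -lt0n.
have -> : n%:R * empirical f s p n phi = \sum_(x <- s) p x * birkhoff f phi n x.
  rewrite empirical_birkhoff mulr_sumr; apply: eq_bigr => x _.
  by rewrite mulrCA mulVKf.
rewrite -sumrN -big_split/= -[LHS]mul1r -gibbs_weight_sum1 mulr_suml.
apply: eq_bigr => x _; rewrite -mulrN -mulrDr; congr (_ * _).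
by rewrite /p /gibbs_weight ln_div ?posrE ?expR_gt0// expRK opprB subrK.
Qed.

(** The entropy of the names of length [n] is cut into blocks of length [q] at all starting times;
    concavity replaces the average of the block entropies over time by the entropy of the
    time-averaged law. *)
Lemma misiurewicz k (xi : borel X -> 'I_k) q : measurable_partition xi ->
  {in s &, injective (itinerary (X := borel X) f xi 0 n)} ->
  q%:R * ln Z <= n%:R * entropy (law (X := borel X)
      (fun A => empirical f s p n \1_A) (itinerary (X := borel X) f xi 0 q)) +
    2 * q%:R ^+ 2 * ln k%:R + q%:R * (n%:R * empirical f s p n phi).
Proof.
move=> mxi inj; rewrite (gibbs_variational inj) mulrDr lerD2r.
have k0 : (0 < k)%N by case: k xi {mxi inj} => [|//] xi'; case: (xi' point).
have cP := point_masses_fa_prob gibbs_weight_ge0 gibbs_weight_sum1.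
apply: le_trans (block_entropy_telescope mf mxi q n cP k0) _.
rewrite lerD2r; under eq_bigr do rewrite block_entropy_shift.
have mi := @measurable_itinerary _ (borel X) f k xi mf mxi 0 q.
pose P (i : 'I_n) t := law (X := borel X) (fun A => point_masses s p (iter i f @^-1` A))
  (itinerary (X := borel X) f xi 0 q) t.
have PE (i : 'I_n) t : P i t = law (X := borel X) (point_masses s p)
  (itinerary (X := borel X) f xi i q) t.
  rewrite /P /law; congr point_masses; apply/seteqP; split => x /= <-;
    by apply/ffunP => j; rewrite !ffunE add0n addnC iterD.
have mi' i := @measurable_itinerary _ (borel X) f k xi mf mxi i q.
apply: le_trans (entropy_concave (p := P) _ _ n_gt0) _.
- by move=> i t; rewrite PE; exact: (law_ge0 _ cP).
- by move=> i; under eq_bigr do rewrite PE; exact: (law_sum1 cP).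
- rewrite le_eqVlt; apply/orP; left; apply/eqP; congr (_ * entropy _).
Qed.

End Misiurewicz.

(** * Upper bound: an invariant measure from optimal separated sets *)

Section UpperBound.
Context {R : realType} {X : pmetricType R} (f : X -> X) (m : nat).
Context (phi : X -> R) (Phi : X -> 'rV[R]_m).
Hypotheses (X_compact : compact [set: X]) (f_continuous : continuous f).
Hypotheses (phi_continuous : continuous phi) (Phi_continuous : continuous Phi).

Lemma Nphi_witness n e w r (y : R) : (y%:E < Nphi f phi Phi n e w r)%E ->
  exists s : seq X, [/\ uniq s, ball_separated f Phi n e w r [set` s] &
    y < \sum_(x <- s) expR (birkhoff f phi n x)].
Proof.
move=> /ereal_sup_gt[_ [F sepF <-]] /ereal_sup_gt[_ [A [fA AF] <-]].
rewrite fsbig_finite// sumEFin lte_fin => yA.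
exists (finmap.enum_fset (fset_set A)); split => //; first exact: finmap.fset_uniq.
have sub : [set` finmap.enum_fset (fset_set A)] `<=` F.
  by move=> x /=; rewrite in_fset_set// inE => /AF.
case: sepF => sep1 sep2; split; first by move=> x x' /sub Fx /sub; exact: sep1.
by move=> x /sub; exact: sep2.
Qed.

Lemma edist_coord (w v : 'rV[R]_m) i : `|v ord0 i - w ord0 i| <= Defs.edist w v.
Proof.
rewrite distrC -sqrtr_sqr /Defs.edist ler_wsqrtr// (bigD1 i)//= lerDl.
by apply: sumr_ge0 => j _; exact: sqr_ge0.
Qed.

(** A limsup controls only an infinite set [Q] of times; the ultrafilter combines what holds on [Q]
    with what holds eventually. *)
Lemma frequently_ultra (Q : set nat) : (forall N, exists2 n, (N <= n)%N & Q n) ->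
  exists U : set_system nat, [/\ UltraFilter U, U Q & \oo `<=` U].
Proof.
move=> frQ.
have pF : ProperFilter (within Q \oo).
  apply: Build_ProperFilter_ex => A [N _ NA]; have [n Nn Qn] := frQ N.
  by exists n; exact: (NA n Nn Qn).
have [U [uU FU]] := ultraFilterLemma pF.
exists U; split => //; first by apply: FU; exists 0.
by move=> A [N _ NA]; apply: FU; exists N => // n Nn _; exact: NA.
Qed.

(* [mu] is the ultralimit of the time averages of the Gibbs-weighted point
   masses on (almost) optimal separated sets. *)
Lemma upper_measure (c e : R) (w : 'rV[R]_m) (r : R) : 0 < e ->
  (forall N, exists2 n, (N <= n)%N &
     ((expR (n%:R * c))%:E < Nphi f phi Phi n e w r)%E) ->
  exists mu : probability (borel X) R, [/\ invariant_measure f mu,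
    forall i, `|rv Phi mu ord0 i - w ord0 i| <= r &
    (c%:E <= free_energy f phi mu)%E].
Proof.
move=> e0 frQ.
have [U [uU UQ Uoo]] := frequently_ultra frQ.
have pU : ProperFilter U := ultra_proper.
have /choice[s_ Hs] : forall n, exists s : seq X,
    ((expR (n%:R * c))%:E < Nphi f phi Phi n e w r)%E ->
    [/\ uniq s, ball_separated f Phi n e w r [set` s] &
      expR (n%:R * c) < \sum_(x <- s) expR (birkhoff f phi n x)].
  move=> n; have [Qn|nQn] := pselect ((expR (n%:R * c))%:E < Nphi f phi Phi n e w r)%E.
    by have [s Hs] := Nphi_witness Qn; exists s.
  by exists [::].
pose Z n := \sum_(x <- s_ n) expR (birkhoff f phi n x).
pose p n := gibbs_weight f phi (s_ n) n.
pose Lam_ n := empirical f (s_ n) (p n) n.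
have good : \forall n \near U, [/\ (0 < n)%N, 0 < Z n, expR (n%:R * c) < Z n,
    uniq (s_ n) & ball_separated f Phi n e w r [set` s_ n]].
  have U1 : \forall n \near U, (0 < n)%N by apply: Uoo; exists 1%N.
  apply: filterS2 UQ U1 => n /Hs [us sep cZ] n0; split => //.
  exact: lt_trans (expR_gt0 _) cZ.
have pLam : \forall n \near U, positive_functional (Lam_ n).
  apply: filterS good => n [n0 Z0 _ _ _]; apply: empirical_positive => //.
    exact: gibbs_weight_ge0.
  exact: gibbs_weight_sum1.
pose Lam := ultralimit U Lam_.
have cvgLam g : bounded_fct g -> Lam_ n g @[n --> U] --> Lam g.
  exact: (ultralimit_cvg uU pLam).
have pL : positive_functional Lam := ultralimit_positive uU pLam.
have Uinv C d : 0 < d -> \forall n \near U, n%:R^-1 * C <= d :> R.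
  move=> d0; have H : \forall n \near U, C / d <= n%:R.
    by apply: Uoo; exact: nbhs_infty_ger.
  apply: filterS2 good H => n [n0 _ _ _ _].
  by rewrite ler_pdivrMr// ler_pdivrMl// ltr0n.
have fLam g : bounded_fct g -> Lam (g \o f) = Lam g.
  move=> [M gM].
  have bgf : bounded_fct (g \o f) by exists M => x; exact: gM.
  have bg : bounded_fct g by exists M.
  have cv : `|Lam_ n (g \o f) - Lam_ n g| @[n --> U] --> `|Lam (g \o f) - Lam g|.
    by apply: cvg_norm; apply: cvgB; exact: cvgLam.
  apply/eqP; rewrite -subr_eq0 -normr_le0; apply/ler_addgt0Pr => d d0.
  rewrite add0r; apply: (cvgr_to_le cv); apply: filterS2 good (Uinv (2 * M) d d0).
  move=> n [n0 Z0 _ _ _]; apply: le_trans.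
  by apply: empirical_comp => //; [exact: gibbs_weight_ge0|exact: gibbs_weight_sum1].
have [mu [meanE muK muU muE]] := riesz X_compact pL.
have imu : invariant_measure f mu.
  exact: (functional_invariant X_compact f_continuous fLam pL muE).
exists mu; split => //.
- move=> i; rewrite [rv _ _ _ _]mxE.
  have ci : continuous (fun x => Phi x ord0 i) by exact: continuous_coord.
  rewrite meanE//.
  have [_ bi] := continuous_bounded_measurable X_compact ci.
  have cv : `|Lam_ n (fun x => Phi x ord0 i) - w ord0 i| @[n --> U] -->
      `|Lam (fun x => Phi x ord0 i) - w ord0 i|.
    by apply: cvg_norm; apply: cvgB; [exact: cvgLam|exact: cvg_cst].
  apply: (cvgr_to_le cv); apply: filterS good => n [n0 Z0 _ _ [_ sw]].
  have ps : \sum_(x <- s_ n) p n x = 1 := gibbs_weight_sum1 Z0.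
  have p0 x : 0 <= p n x := gibbs_weight_ge0 Z0 x.
  have sumE (a : R) : a = \sum_(x <- s_ n) p n x * a by rewrite -mulr_suml ps mul1r.
  rewrite /Lam_ empirical_birkhoff [w ord0 i]sumE -sumrB.
  apply: (le_trans (ler_norm_sum _ _ _)).
  rewrite [leRHS]sumE big_seq [leRHS]big_seq.
  apply: ler_sum => x xs.
  rewrite -mulrBr normrM [`|p n x|]ger0_norm; last exact: p0.
  rewrite ler_wpM2l ?p0//.
  rewrite -birkhoff_coord (le_trans (edist_coord _ _ _))// ltW//.
  exact: sw.
(* Cells of diameter below [e] give distinct names of length [n] to the points of an
   [(n, e)]-separated set. *)
- have [k [xi [mxi jxi xie]]] := small_jordan_partition mu X_compact e0.
  have k0 : (0 < k)%N by case: k xi {mxi jxi xie} => [|//] xi'; case: (xi' point).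
  apply: (@le_trans _ _ ((partition_entropy f mu xi)%:E + (mean mu phi)%:E)%E); last first.
    by rewrite leeD2r//; apply: ereal_sup_ubound; exists k, xi.
  rewrite -EFinD lee_fin -lerBlDr.
  have mf := continuous_borel f_continuous.
  have [_] := partition_entropy_cvg mf imu mxi; apply=> q q0.
  have qR : 0 < q%:R :> R by rewrite ltr0n.
  rewrite ler_pdivlMl// mulrBr lerBlDr join_entropyE /block_entropy.
  set L := itinerary (X := borel X) f xi 0 q.
  have mL : measurable_label (X := borel X) L by exact: (@measurable_itinerary _ (borel X)).
  have cP := prob_fa_prob mu.
  (* The cells of the join inherit null boundaries by invariance of [mu], so [Lam] and [mu] give the
     names the same law. *)
  have lawE t : law (X := borel X) (fun A => Lam \1_A) L t = law (X := borel X) (prob mu) L t.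
    apply: (jordan_functional pL muK muU); first exact: mL.
    rewrite (_ : L @^-1` [set t] = \bigcap_(i : 'I_q) (iter i f @^-1` (xi @^-1` [set t i]))).
      by apply: jordan_bigcap => i; apply: jordan_iter.
    apply/seteqP; split => x /= => [<- i _|xs]; rewrite ?ffunE//.
    by apply/ffunP => i; rewrite ffunE; exact: xs.
  apply/ler_addgt0Pr => d d0; have d2 : 0 < d / 2 by rewrite divr_gt0.
  have [Q [Q0 Q1 QH]] := entropy_approx (fun t => law_ge0 t cP mL) (law_sum1 cP mL) d2.
  (* [G] does not depend on [n]: Gibbs' inequality bounds the entropy in Misiurewicz's estimate by
     the cross entropy against [Q], so the estimate bounds [Lam_ n G] from below and passes to the
     ultralimit. *)
  pose G x := - ln (Q (L x)) + q%:R * phi x.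
  have [_ bphi] := continuous_bounded_measurable X_compact phi_continuous.
  have bQ : bounded_fct (fun x => - ln (Q (L x))).
    exists (\sum_t `|ln (Q t)|) => x; rewrite normrN (bigD1 (L x))//= lerDl.
    exact: sumr_ge0.
  have bG : bounded_fct G by apply: bounded_fctD => //; exact: bounded_fctZ.
  have GE Lm : positive_functional Lm -> Lm G =
      - \sum_t law (X := borel X) (fun A => Lm \1_A) L t * ln (Q t) + q%:R * Lm phi.
    move=> pLm; rewrite (functionalD pLm)//; last exact: bounded_fctZ.
    rewrite (functionalZ pLm)//; congr (_ + _).
    rewrite (functional_label L (fun t => - ln (Q t)) pLm) -sumrN.
    by apply: eq_bigr => t _; rewrite mulrN.
  have main : q%:R * c - d / 2 <= Lam G.
    apply: (cvgr_to_ge (cvgLam G bG)).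
    apply: filterS3 good pLam (Uinv (2 * q%:R ^+ 2 * ln k%:R) _ d2).
    move=> n [n0 Z0 cZ us [sep _]] pLn hd; rewrite (GE _ pLn).
    have nR : 0 < n%:R :> R by rewrite ltr0n.
    have inj : {in s_ n &, injective (itinerary (X := borel X) f xi 0 n)}.
      move=> x y xs ys xy; apply: contrapT => ne.
      have := sep x y xs ys ne; rewrite leNgt => /negP; apply.
      rewrite /bowen_dist; apply: bigmax_lt => // i _; apply: xie.
      by move/ffunP : xy => /(_ i); rewrite !ffunE add0n.
    have := @misiurewicz _ _ f phi f_continuous (s_ n) n us n0 Z0 k xi q mxi inj.
    rewrite -/(p n) -/(Lam_ n) => H.
    have lnZ : n%:R * c <= ln (Z n).
      by rewrite -[leLHS]expRK ler_ln ?posrE ?expR_gt0// ltW.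
    have {}H : q%:R * c <= entropy (law (X := borel X) (fun A => Lam_ n \1_A) L) +
        n%:R^-1 * (2 * q%:R ^+ 2 * ln k%:R) + q%:R * Lam_ n phi.
      rewrite -(ler_pM2l nR); apply: le_trans (_ : q%:R * ln (Z n) <= _).
        by rewrite mulrCA ler_pM2l.
      apply: (le_trans H); rewrite !mulrDr [n%:R * (q%:R * _)]mulrCA lerD2r lerD2l.
      by rewrite [leRHS]mulVKf// lt0r_neq0.
    have : entropy (law (X := borel X) (fun A => Lam_ n \1_A) L) <=
        - \sum_t law (X := borel X) (fun A => Lam_ n \1_A) L t * ln (Q t).
      apply: gibbs.
      - move=> t; rewrite /law -(functional_cst pLn 0); apply: (functional_le pLn).
        + exact: bounded_fct_cst.
        + exact: bounded_fct_indic.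
        + by move=> x; rewrite indicE.
      - by move=> t; exact: ltW.
      - by move=> t Qt; have := Q0 t; rewrite Qt ltxx.
      - apply: (le_trans Q1); rewrite -[leLHS](functional_cst pLn 1).
        rewrite (functional_label L (fun=> 1) pLn).
        by under eq_bigr do rewrite mulr1.
    by move: H hd; lra.
  move: main; rewrite (GE _ pL) meanE//.
  under eq_bigr do rewrite lawE.
  by move: QH; lra.
Qed.

End UpperBound.

(** * Localized growth rates in the extended reals and the conclusion *)

Section ExtendedReals.
Context {R : realType}.
Local Open Scope ereal_scope.

Lemma real_between (x y : \bar R) : x < y -> exists c : R, x < c%:E < y.
Proof.
case: x y => [x| |] [y| |] //=; rewrite ?lte_fin => xy.
- by exists ((x + y) / 2)%R; rewrite !lte_fin !midf_lt.
- by exists (x + 1)%R; rewrite lte_fin ltrDl ltr01 ltry.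
- by exists (y - 1)%R; rewrite ltNyr lte_fin gtrBl ltr01.
- by exists 0%R; rewrite ltNyr ltry.
Qed.

Lemma lne_expR_le (n : nat) (c : R) (z : \bar R) : (0 < n)%N ->
  (expR (n%:R * c))%:E <= z -> c%:E <= (n%:R^-1)%:E * lne z.
Proof.
move=> n0 cz; have nR : (0 < n%:R :> R)%R by rewrite ltr0n.
have -> : c%:E = (n%:R^-1)%:E * (n%:R * c)%:E.
  by rewrite -EFinM mulKf// lt0r_neq0.
rewrite lee_pmul2l ?lte_fin ?invr_gt0//.
rewrite -[leLHS](_ : lne (expR (n%:R * c))%:E = _); last first.
  by rewrite lne_EFin ?expR_gt0// expRK.
by rewrite lee_lne// in_itv/= leey andbT ?lee_fin ?expR_ge0// (le_trans _ cz)// lee_fin expR_ge0.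
Qed.

Lemma lne_expR_lt (n : nat) (c : R) (z : \bar R) : (0 < n)%N -> 0 <= z ->
  c%:E < (n%:R^-1)%:E * lne z -> (expR (n%:R * c))%:E < z.
Proof.
move=> n0 z0; apply: contraTT; rewrite -!leNgt => zc.
have nR : (0 < n%:R :> R)%R by rewrite ltr0n.
have -> : c%:E = (n%:R^-1)%:E * (n%:R * c)%:E.
  by rewrite -EFinM mulKf// lt0r_neq0.
rewrite lee_pmul2l ?lte_fin ?invr_gt0//.
rewrite -[leRHS](_ : lne (expR (n%:R * c))%:E = _); last first.
  by rewrite lne_EFin ?expR_gt0// expRK.
by rewrite lee_lne// in_itv/= leey andbT// lee_fin expR_ge0.
Qed.

Lemma limn_esup_le (u v : (\bar R)^nat) : (forall n, u n <= v n) ->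
  limn_esup u <= limn_esup v.
Proof.
move=> uv; apply: le_ereal_inf_tmp => _ [V oV <-].
apply: (@le_trans _ _ (ereal_sup (u @` V))).
  by apply: ereal_inf_lbound; exists V.
apply: ge_ereal_sup => _ [n Vn <-]; apply: le_trans (uv n) _.
by apply: ereal_sup_ubound; exists n.
Qed.

Lemma limn_esup_gt (u : (\bar R)^nat) c : c < limn_esup u ->
  forall N, exists2 n, (N <= n)%N & c < u n.
Proof.
move=> cu N; have : c < ereal_sup (u @` [set n | (N <= n)%N]).
  by apply: lt_le_trans cu _; apply: ereal_inf_lbound; exists [set n | (N <= n)%N] => //; exists N.
by move=> /ereal_sup_gt[_ [n Nn <-] cn]; exists n.
Qed.

Lemma limn_esup_ge (u : (\bar R)^nat) c : (\forall n \near \oo, c <= u n) ->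
  c <= limn_esup u.
Proof.
move=> cu; apply: le_ereal_inf_tmp => _ [V oV <-].
have /filter_ex[n [Vn cn]] : \forall n \near \oo, V n /\ c <= u n by exact: filterI.
by apply: le_trans cn _; apply: ereal_sup_ubound; exists n.
Qed.

End ExtendedReals.

Section LocalizedPressure.
Context {R : realType} {X : pmetricType R} (f : X -> X) (m : nat).
Context (phi : X -> R) (Phi : X -> 'rV[R]_m) (w : 'rV[R]_m).
Local Open Scope ereal_scope.

Lemma Nphi_ge0 n e r : 0 <= Nphi f phi Phi n e w r.
Proof.
apply: ereal_sup_ubound; exists set0; last by rewrite esum_set0.
by split => [x y|x].
Qed.

Lemma le_Nphi n e e' r r' : (e' <= e)%R -> (r <= r')%R ->
  Nphi f phi Phi n e w r <= Nphi f phi Phi n e' w r'.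
Proof.
move=> ee' rr'; apply: ge_ereal_sup => _ [F [sepF wF] <-].
apply: ereal_sup_ubound; exists F => //; split.
  by move=> x y Fx Fy xy; rewrite (le_trans ee')// sepF.
by move=> x Fx; rewrite (lt_le_trans _ rr')// wF.
Qed.

Definition growth (e r : R) : \bar R :=
  limn_esup (fun n : nat => (n%:R^-1)%:E * lne (Nphi f phi Phi n e w r)).

Lemma le_growth e e' r r' : (e' <= e)%R -> (r <= r')%R ->
  growth e r <= growth e' r'.
Proof.
move=> ee' rr'; apply: limn_esup_le => n; apply: lee_wpmul2l.
  by rewrite lee_fin invr_ge0.
by rewrite lee_lne ?in_itv/= ?leey ?Nphi_ge0// le_Nphi.
Qed.

Definition local_growth (r : R) : \bar R := lim (growth e r @[e --> 0^'+]).

Lemma growth_cvg r : cvg (growth e r @[e --> 0^'+]).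
Proof.
apply: nonincreasing_at_right_is_cvge; apply: nearW => x e e' _ _ ee'.
exact: le_growth.
Qed.

Lemma le_local_growth r r' : (r <= r')%R -> local_growth r <= local_growth r'.
Proof.
move=> rr'; apply: lee_lim; [exact: growth_cvg|exact: growth_cvg|].
by apply: nearW => e; exact: le_growth.
Qed.

Lemma local_growth_cvg : cvg (local_growth r @[r --> 0^'+]).
Proof.
apply: nondecreasing_at_right_is_cvge; apply: nearW => x r r' _ _ rr'.
exact: le_local_growth.
Qed.

Lemma PtopE : Ptop f phi Phi w = lim (local_growth r @[r --> 0^'+]).
Proof. by []. Qed.

Hypotheses (X_compact : compact [set: X]) (f_continuous : continuous f).
Hypotheses (phi_continuous : continuous phi) (Phi_continuous : continuous Phi).

(** Otherwise some rate [c'] above [c] is exceeded at infinitely many times, and [upper_measure]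
    gives an invariant measure of free energy at least [c'] whose rotation vector is within [r] of
    [w] in each coordinate, hence in the given neighbourhood once [r < d]. *)
Lemma Ptop_le (c : R) :
  (\forall v \near within (Rot f Phi) (nbhs w), Pm f phi Phi v < c%:E) ->
  Ptop f phi Phi w <= c%:E.
Proof.
rewrite near_withinE => /nbhs_ballP[d /= d0 H].
rewrite PtopE; apply: lime_le; first exact: local_growth_cvg.
near=> r; apply: lime_le; first exact: growth_cvg.
near=> e; have e0 : (0 < e)%R by near: e; exact: nbhs_right_gt.
rewrite leNgt; apply/negP => /real_between[c' /andP[cc']] /limn_esup_gt frq.
have [N|mu [imu rvmu fe]] := @upper_measure R X f m phi Phi X_compact f_continuous
    phi_continuous Phi_continuous c' e w r e0.
  (* Starting at [N.+1] excludes [n = 0], where the inverse of [n] is 0. *)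
  have [n Nn cn] := frq N.+1; exists n; first exact: ltnW.
  apply: lne_expR_lt => //; [exact: leq_trans Nn|exact: Nphi_ge0].
have : Pm f phi Phi (rv Phi mu) < c%:E.
  apply: H; last by exists mu.
  split=> // i j; rewrite (ord1 i) -ball_normE /= distrC.
  apply: le_lt_trans (rvmu j) _; near: r; exact: nbhs_right_lt.
apply/negP; rewrite -leNgt; apply: le_trans (ltW cc') _; apply: le_trans fe _.
by apply: ereal_sup_ubound; exists mu.
Unshelve. all: by end_near. Qed.

Lemma Ptop_ge (c : R) :
  (forall r, (0 < r)%R -> exists mu : probability (borel X) R,
    [/\ ergodic_measure f mu, (Defs.edist w (rv Phi mu) < r)%R &
      c%:E < free_energy f phi mu]) ->
  c%:E <= Ptop f phi Phi w.
Proof.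
move=> H; rewrite PtopE; apply: lime_ge; first exact: local_growth_cvg.
near=> r; have r0 : (0 < r)%R by near: r; exact: nbhs_right_gt.
apply: lime_ge; first exact: growth_cvg.
have [mu [erg wr]] := H r r0.
rewrite /free_energy -lteBlDr// => /ereal_sup_gt[_ [k [xi [mxi ->]]]].
rewrite lteBlDr// -EFinD lte_fin => cmu.
(* The loss [eta] is chosen so that the exponent becomes exactly [n * c]. *)
have := @Nphi_lower_bound R X f m phi Phi X_compact f_continuous
  phi_continuous Phi_continuous mu k xi erg mxi w r
  (partition_entropy f mu xi + mean mu phi - c) wr.
rewrite subr_gt0 => /(_ cmu); apply: filterS => e He.
apply: limn_esup_ge; near=> n; apply: lne_expR_le.
  by near: n; exists 1%N.
have : (expR (n%:R * (partition_entropy f mu xi + mean mu phi -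
    (partition_entropy f mu xi + mean mu phi - c))))%:E <=
    Nphi f phi Phi n e w r by near: n.
by rewrite opprB [X in (n%:R * X)%R]addrC subrK.
Unshelve. all: by end_near. Qed.

End LocalizedPressure.

Theorem theoremA (R : realType) (X : pmetricType R) (f : X -> X) (m : nat)
    (phi : X -> R) (Phi : X -> 'rV[R]_m) (w : 'rV[R]_m)
    (X_compact : compact [set: X])
    (X_besicovitch : besicovitch_space X)
    (f_continuous : continuous f)
    (htop_finite : (htop f < +oo)%E)
    (phi_continuous : continuous phi)
    (Phi_continuous : continuous Phi)
    (w_Rot : Rot f Phi w)
    (Pm_continuous_at_w :
      Pm f phi Phi v @[v --> within (Rot f Phi) (nbhs w)] --> Pm f phi Phi w)
    (w_approximated : ergodic_approximated f phi Phi w) :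
  Ptop f phi Phi w = Pm f phi Phi w.
Proof.
(* A real [c] strictly between the two sides is used for each inequality, which covers infinite
   values as well. *)
apply/eqP; rewrite eq_le; apply/andP; split; rewrite leNgt; apply/negP.
  move=> /real_between[c /andP[Pc /lt_geF]]; rewrite Ptop_le//.
  apply: (Pm_continuous_at_w [set z | (z < c%:E)%E]); apply: open_nbhs_nbhs; split => //.
  exact: open_ereal_lt_ereal.
move=> /real_between[c /andP[+ cP]]; apply/negP; rewrite -leNgt.
apply: Ptop_ge => // r r0; have [mu_ [erg rvw few]] := w_approximated.
(* Openness of the Euclidean ball at its centre turns sup-norm convergence of the rotation vectors
   into Euclidean closeness. *)
have ww : Defs.edist w w < r.
  by rewrite /Defs.edist big1 ?sqrtr0// => i _; rewrite subrr expr0n.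
have [d d0 Hd] := edist_near ww.
have near1 : \forall n \near \oo, Defs.edist w (rv Phi (mu_ n)) < r.
  have wd : \forall n \near \oo, ball w d (rv Phi (mu_ n)).
    exact: (rvw (ball w d) (nbhsx_ballx w d d0)).
  apply: filterS wd => n wn.
  apply: Hd => i; rewrite distrC ltW//.
  by have := wn.2 ord0 i; rewrite -ball_normE.
have near2 : \forall n \near \oo, (c%:E < free_energy f phi (mu_ n))%E.
  apply: (few [set z | (c%:E < z)%E]); apply: open_nbhs_nbhs; split => //; exact: open_ereal_gt_ereal.
have [n [wn cn]] := filter_ex (filterI near1 near2).
by exists (mu_ n).
Qed.
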